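(* (1) For all $p \in (0, 1/7)$, $\mathrm{ed}_{\mathrm{Forb}(C_{10})}(p) = \frac{p(1-p)}{1+2p}$. (2) For all $p \in (0, 1/10)$, $\mathrm{ed}_{\mathrm{Forb}(C_{12})}(p) = \frac{p(1-p)}{1+2p}$.
   Context: $C_h$ is the cycle on $h$ vertices. $\mathrm{Forb}(H)$ denotes the class of all graphs that do not contain $H$ as an induced subgraph. For graphs $G, G'$ on the same $n$-vertex set, $\mathrm{dist}(G,G') = |E(G) \triangle E(G')| / \binom{n}{2}$; for a class $\mathcal{H}$ of graphs, $\mathrm{dist}(G,\mathcal{H}) = \min\{\mathrm{dist}(G,G') : G' \in \mathcal{H}, V(G') = V(G)\}$. The edit distance function is \[ \mathrm{ed}_{\mathcal{H}}(p) = \lim_{n\to\infty} \max\{\mathrm{dist}(G,\mathcal{H}) : |V(G)| = n, |E(G)| = \lfloor p\binom{n}{2} \rfloor\}, \] which exists for every non-trivial hereditary property $\mathcal{H}$. *)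

(* Defs.v *)
From HB Require Import structures.
From mathcomp Require Import all_boot all_order all_algebra.
From mathcomp Require Import all_classical all_reals all_analysis.

Set Implicit Arguments.
Unset Strict Implicit.
Unset Printing Implicit Defensive.

Import Order.TTheory GRing.Theory Num.Theory.
Import numFieldNormedType.Exports.

Local Open Scope ring_scope.

Section Graphs.

Variable T : finType.

Record graph := Graph {
  edges : {set {set T}};
  edges_card2 : [forall e in edges, #|e| == 2%N] }.

HB.instance Definition _ := [isSub for edges].
HB.instance Definition _ := [Finite of graph by <:].

Definition adj (G : graph) (x y : T) : bool := [set x; y]%SET \in edges G.

End Graphs.

(* The side condition i != ordS i only matters for h = 1; the result is the
   cycle on h vertices as soon as h >= 3. *)
Definition cycle_edges (h : nat) : {set {set 'I_h}} :=
  [set [set i; ordS i]%SET | i : 'I_h & i != ordS i]%SET.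

Lemma cycle_edges_card2 (h : nat) :
  [forall e in cycle_edges h, #|e| == 2%N].
Proof.
apply/forall_inP => e /imsetP[i]; rewrite inE => ni ->.
by rewrite cards2 ni.
Qed.

Definition C_ (h : nat) : graph 'I_h := Graph (cycle_edges_card2 h).

Definition induced_subgraph (U T : finType) (H : graph U) (G : graph T) : bool :=
  [exists f : {ffun U -> T},
     injectiveb f && [forall x, forall y, adj G (f x) (f y) == adj H x y]].

Definition graph_class := forall T : finType, pred (graph T).

Definition Forb (U : finType) (H : graph U) : graph_class :=
  fun T G => ~~ induced_subgraph H G.

Section EditDistance.

Variable R : realType.

Definition dist (T : finType) (G G' : graph T) : R :=
  #|((edges G :\: edges G') :|: (edges G' :\: edges G))%SET|%:R
  / 'C(#|T|, 2)%:R.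

(* Since dist G G' <= 1, the default value 1 does not affect the minimum when
   the class has a member on the vertex set T. *)
Definition dist_class (T : finType) (G : graph T) (P : graph_class) : R :=
  \big[Num.min/1]_(G' : graph T | P T G') dist G G'.

(* Distances are nonnegative, so the default value 0 does not affect the
   maximum, whose range is nonempty for 0 <= p <= 1.  Graphs on n vertices are
   taken on 'I_n, which is no restriction for isomorphism-closed classes. *)
Definition max_dist (P : graph_class) (p : R) (n : nat) : R :=
  \big[Num.max/0]_(G : graph 'I_n |
      #|edges G|%:Z == Num.floor (p * 'C(n, 2)%:R)) dist_class G P.

Definition ed (P : graph_class) (p : R) : R := limn (max_dist P p).

End EditDistance.

(* Main.v *)
Require Import Defs.
From HB Require Import structures.
From mathcomp Require Import all_boot all_order all_algebra.
From mathcomp Require Import all_classical all_reals all_analysis.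
From mathcomp Require Import ring lra.

(* Upper bound: colour the vertices at random, one colour having weight
   (1 - p) / (1 + 2 p) and three having weight p / (1 + 2 p); delete the edges
   inside the first class and complete the other three.  The result is induced
   C_h-free because an independent set and three cliques cannot cover C_h.

   Lower bound: let G be quasirandom of density p and G' induced C_h-free.  A
   weakly regular partition replaces G' by a symmetric kernel W, and the
   distance from G to G' is at least the mean of |W - p|.  Calling a pair
   white, black or gray when W is near 0, near 1 or in between, the counting
   lemma shows that few h-tuples of vertices realize C_h compatibly with these
   colours.  By supersaturation and Ramsey's theorem the colouring of a typical
   k-tuple extends to a colouring of its vertices into which C_h does not
   embed, and it remains to bound below the quadratic form attached to such a
   coloured complete graph.  At a minimum with minimal support there are no
   black pairs.  If there is a white vertex then it is the only one and, as its
   gray neighbours number at most three, Lagrange's conditions give the bound;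
   if all vertices are black and the bound fails then Lagrange's conditions
   force a gray hexagon, which C_h contracts to. *)

Set Implicit Arguments.
Unset Strict Implicit.
Unset Printing Implicit Defensive.

Import Order.TTheory GRing.Theory Num.Theory.
Import numFieldNormedType.Exports.

Local Open Scope ring_scope.

(** The value $p(1-p)/(1+2p) = 1/(1/p + 3/(1-p))$ is the minimum of the quadratic form of one white
    and three black vertices with all pairs gray; it is attained at weights inversely proportional
    to the diagonal costs $p$ and $1-p$, which are the weights of the random colouring. A fourth
    black vertex is excluded because $C_h$ splits into four independent vertices and four arcs of at
    most two vertices. In the all-black case $7p < 1$ reads $9\mu < 1$ with $\mu = p/(1+2p)$. The
    obstacle is the diagonal. Several vertices of $C_h$ may be sent to one vertex of a coloured
    graph, so vertices need a colour, white or black, which the kernel $W$ does not provide. Hence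
    the detour through $k$-tuples: the colour of a vertex is read off a homogeneous set among many
    interchangeable copies of it, and the diagonal weighs only $1/k$ in the form with uniform
    weights, so these colours cost nothing in the limit. Cut-norm regularity suffices because the
    counting lemma replaces one pair at a time. *)

(** * Minimizing a quadratic form on the simplex *)

Section QuadraticForm.
Variables (R : realType) (n : nat) (M : 'I_n -> 'I_n -> R).
Hypothesis symM : forall i j, M i j = M j i.

Definition qform (x : 'I_n -> R) : R := \sum_i \sum_j x i * x j * M i j.

Lemma qform_shift (x : 'I_n -> R) (u v : 'I_n) (s : R) :
  qform (fun i => x i + s * ((i == u)%:R - (i == v)%:R)) =
  qform x + 2 * s * (\sum_j x j * M u j - \sum_j x j * M v j)
    + s ^+ 2 * (M u u + M v v - 2 * M u v).
Proof.
have delta (w : 'I_n) (F : 'I_n -> R) : \sum_i (i == w)%:R * F i = F w.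
  rewrite (bigD1 w) //= eqxx mul1r big1 ?addr0 // => i /negPf->.
  by rewrite mul0r.
pose L i := \sum_j x j * M i j.
have E1 i : \sum_j (x i + s * ((i == u)%:R - (i == v)%:R)) *
     (x j + s * ((j == u)%:R - (j == v)%:R)) * M i j =
   x i * L i + s * (x i * (M i u - M i v)) +
   s * ((i == u)%:R * L i - (i == v)%:R * L i) +
   s ^+ 2 * ((i == u)%:R * (M i u - M i v) - (i == v)%:R * (M i u - M i v)).
  have -> : \sum_j (x i + s * ((i == u)%:R - (i == v)%:R)) *
      (x j + s * ((j == u)%:R - (j == v)%:R)) * M i j =
      (x i + s * ((i == u)%:R - (i == v)%:R)) *
      (L i + s * (\sum_j (j == u)%:R * M i j - \sum_j (j == v)%:R * M i j)).
    rewrite -sumrB !big_distrr /= -big_split /= big_distrr /=.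
    by apply: eq_bigr => j _; ring.
  by rewrite !delta; ring.
rewrite /qform (eq_bigr _ (fun i _ => E1 i)) !big_split /= -!mulr_sumr !sumrB.
rewrite !delta.
have -> : \sum_i x i * (M i u - M i v) = L u - L v.
  rewrite /L -sumrB; apply: eq_bigr => j _.
  by rewrite (symM u) (symM v) mulrBr.
have -> : \sum_i x i * L i = \sum_i \sum_j x i * x j * M i j.
  apply: eq_bigr => i _; rewrite /L mulr_sumr.
  by apply: eq_bigr => j _; rewrite mulrA.
rewrite (symM v u) -/(L u) -/(L v); ring.
Qed.

Lemma continuous_sumr (T : topologicalType) (F : 'I_n -> T -> R) :
  (forall i, continuous (F i)) -> continuous (fun x => \sum_i F i x).
Proof.
move=> cF; pose F' i : T -> R^o := F i.
apply: (@continuous_big R^o _ +%R 0 xpredT _ T (index_enum _) F') => //.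
exact: pseudometric_normed_Zmodule.add_continuous.
Qed.

Lemma continuous_qform :
  continuous (fun x : 'rV[R]_n => qform (fun i => x ord0 i)).
Proof.
apply: continuous_sumr => i; apply: continuous_sumr => j x.
have c k : {for x, continuous (fun v : 'rV[R]_n => v ord0 k)}.
  exact: coord_continuous.
apply: (continuousM (continuousM (c i) (c j))).
exact: cst_continuous.
Qed.

Definition supported (A : {set 'I_n}) (x : 'I_n -> R) :=
  [/\ forall i, 0 <= x i, \sum_i x i = 1 & forall i, i \notin A -> x i = 0].

Lemma qform_minimizer (A : {set 'I_n}) (x0 : 'I_n -> R) :
  supported A x0 ->
  exists x, supported A x /\ forall y, supported A y -> qform x <= qform y.
Proof.
move=> sx0.
pose S := [set v : 'rV[R]_n | supported A (fun i => v ord0 i)]%classic.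
have cS : compact S.
  pose I i : set R := if i \in A then `[0, 1]%classic else `[0, 0]%classic.
  have cB : compact [set v : 'rV[R]_n | forall i, I i (v ord0 i)]%classic.
    apply: (@rV_compact R n I) => i; rewrite /I; case: ifP => _; exact: segment_compact.
  have clS : closed [set v : 'rV[R]_n | \sum_i v ord0 i = 1]%classic.
    have -> : [set v : 'rV[R]_n | \sum_i v ord0 i = 1]%classic =
       ((fun v : 'rV[R]_n => \sum_i v ord0 i) @^-1` [set x | x = 1])%classic by [].
    apply: preimage_closed; last exact: closed_eq.
    have cs : continuous (fun v : 'rV[R]_n => \sum_i v ord0 i).
      by apply: continuous_sumr => i; apply: coord_continuous.
    by move=> v *; exact: cs.
  have -> : S = ([set v : 'rV[R]_n | \sum_i v ord0 i = 1] `&`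
      [set v : 'rV[R]_n | forall i, I i (v ord0 i)])%classic.
    apply/seteqP; split => v /=.
      move=> [v0 v1 vA]; split => // i; rewrite /I.
      case: ifPn => iA /=; rewrite in_itv /= v0 /=.
        by rewrite -v1 (bigD1 i) //= lerDl sumr_ge0.
      by rewrite vA.
    move=> [v1 vI]; split=> // [i|i /negPf iA]; move: (vI i); rewrite /I.
      by case: ifP => _ /=; rewrite in_itv /= => /andP[].
    by rewrite iA /= in_itv /= => /le_anti.
  by rewrite setIC; exact: compact_closedI.
have S0 : (S !=set0)%classic.
  exists (\row_i x0 i) => /=; case: sx0 => a b c; split => [i||i /c <-]; rewrite ?mxE //.
  by rewrite -b; apply: eq_bigr => i _; rewrite mxE.
have [|v vS vmin] := EVT_min_rV S0 cS (f := fun x => qform (fun i => x ord0 i)).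
  by apply: continuous_subspaceT => v; exact: continuous_qform.
exists (fun i => v ord0 i); split; first by rewrite inE in vS.
move=> y [a b c].
have := vmin (\row_i y i); rewrite inE => /(_ _)/le_trans; apply.
  split => [i||i /c <-]; rewrite ?mxE //.
  by rewrite -b; apply: eq_bigr => i _; rewrite mxE.
rewrite le_eqVlt; apply/orP; left; apply/eqP.
by rewrite /qform; do 2!(apply: eq_bigr => ? _); rewrite !mxE.
Qed.

(* Among the sets carrying a weight of value below [c] take a smallest one and
   minimize on it: moving weight between two points of the support then has
   zero first variation, and nonpositive second variation would let one of the
   two points be dropped. *)
Lemma qform_core (c : R) (x0 : 'I_n -> R) :
  (forall i, 0 <= x0 i) -> \sum_i x0 i = 1 -> qform x0 < c ->
  exists (A : {set 'I_n}) (x : 'I_n -> R),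
  [/\ supported A x, forall i, i \in A -> 0 < x i, qform x < c,
      forall i, i \in A -> \sum_j x j * M i j = qform x &
      forall u v, u \in A -> v \in A -> u != v -> 2 * M u v < M u u + M v v].
Proof.
move=> x0ge0 x01 x0c.
pose P (A : {set 'I_n}) := `[< exists x, supported A x /\ qform x < c >].
have PT : P [set: 'I_n]%SET.
  by apply/asboolP; exists x0; split => //; split => // i; rewrite inE.
case: (arg_minnP (fun A : {set 'I_n} => #|A|) PT) => A /asboolP[x1 [sx1 x1c]] Amin.
have [x [sx xmin]] := qform_minimizer sx1.
have xc : qform x < c by apply: le_lt_trans x1c; exact: xmin.
have [x_ge0 x_sum xA] := sx.
have dropF (y : 'I_n -> R) u : u \in A -> supported A y -> y u = 0 ->
    qform y < c -> False.
  move=> uA [y0 y1 yA] yu yc.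
  have /Amin : P (A :\ u)%SET.
    apply/asboolP; exists y; split => //; split => // i.
    rewrite !inE negb_and negbK => /orP[/eqP->//|]; exact: yA.
  by rewrite (cardsD1 u A) uA add1n ltnn.
have x_gt0 i : i \in A -> 0 < x i.
  move=> iA; rewrite lt_def x_ge0 andbT; apply/eqP => xi0.
  exact: (dropF x i).
pose sh u v s := fun i => x i + s * ((i == u)%:R - (i == v)%:R).
have shS u v s : u \in A -> v \in A -> u != v -> - x u <= s -> s <= x v ->
    supported A (sh u v s).
  move=> uA vA uv su sv; split.
  - move=> i; rewrite /sh; have [->|iu] := eqVneq i u.
      by rewrite (negPf uv) /=; lra.
    by have [->|iv] := eqVneq i v => /=; [lra|have := x_ge0 i; lra].
  - rewrite /sh big_split /= x_sum -mulr_sumr sumrB.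
    have D w : \sum_i (i == w)%:R = 1 :> R.
      by rewrite (bigD1 w) //= eqxx big1 ?addr0 // => i /negPf->.
    by rewrite !D; lra.
  - move=> i iA; rewrite /sh xA //.
    have /negPf-> : i != u by apply: contraNneq iA => ->.
    have /negPf-> : i != v by apply: contraNneq iA => ->.
    by lra.
have L_eq u v : u \in A -> v \in A ->
    \sum_j x j * M u j = \sum_j x j * M v j.
  move=> uA vA; have [->//|uv] := eqVneq u v.
  set a := \sum_j _; set b := \sum_j _; apply/eqP; rewrite -subr_eq0.
  apply/eqP; set d := a - b.
  set e := M u u + M v v - 2 * M u v.
  have H s : - x u <= s -> s <= x v -> 0 <= 2 * s * d + s ^+ 2 * e.
    move=> su sv; have := xmin _ (shS u v s uA vA uv su sv).
    by rewrite /sh qform_shift -/a -/b -/d -/e; lra.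
  have xu := x_gt0 _ uA; have xv := x_gt0 _ vA.
  have [d0|d0|//] := ltgtP d 0.
    (* A step of length at most $|d|/(1+|e|)$ keeps the quadratic term below the linear one, so a
       nonzero first variation contradicts minimality; the cap [x v] keeps the weights
       nonnegative. *)
    pose r := - d / (1 + `|e|).
    have e1 : 0 < 1 + `|e| by rewrite ltr_pwDl.
    have r0 : 0 < r by rewrite divr_gt0 // oppr_gt0.
    pose s := Num.min r (x v).
    have s0 : 0 < s by rewrite lt_min r0.
    have := H s; rewrite ge_min lexx orbT => /(_ _ isT).
    have /[swap]/[apply] : - x u <= s by rewrite (le_trans _ (ltW s0)) // oppr_le0 ltW.
    have sr : s * (1 + `|e|) <= - d.
      by rewrite -ler_pdivlMr // ge_min lexx.
    have : s * e <= s * (1 + `|e|).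
      by apply: ler_wpM2l; [exact: ltW | have := ler_norm e; lra].
    move=> h1 h2.
    have : 0 <= s * (2 * d + s * e) by apply: le_trans h2 _; rewrite le_eqVlt; apply/orP; left; apply/eqP; ring.
    by rewrite pmulr_rge0 //; lra.
  pose r := d / (1 + `|e|).
  have e1 : 0 < 1 + `|e| by rewrite ltr_pwDl.
  have r0 : 0 < r by rewrite divr_gt0 // oppr_gt0.
  pose s := Num.min r (x u).
  have s0 : 0 < s by rewrite lt_min r0.
  have := H (- s); rewrite lerN2 ge_min lexx orbT => /(_ isT).
  have /[swap]/[apply] : - s <= x v by rewrite lerNl (le_trans _ (ltW s0)) // oppr_le0 ltW.
  have sr : s * (1 + `|e|) <= d.
    by rewrite -ler_pdivlMr // ge_min lexx.
  have : s * e <= s * (1 + `|e|).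
    by apply: ler_wpM2l; [exact: ltW | have := ler_norm e; lra].
  move=> h1 h2.
  have : 0 <= s * (- 2 * d + s * e) by apply: le_trans h2 _; rewrite le_eqVlt; apply/orP; left; apply/eqP; ring.
  by rewrite pmulr_rge0 //; lra.
exists A, x; split => // [i iA|u v uA vA uv].
  have E1 : qform x = \sum_k x k * \sum_j x j * M k j.
    apply: eq_bigr => k _; rewrite mulr_sumr.
    by apply: eq_bigr => j _; rewrite mulrA.
  rewrite E1 -[LHS]mul1r -x_sum mulr_suml; apply: eq_bigr => k _.
  have [kA|kA] := boolP (k \in A); first by rewrite (L_eq _ _ kA iA).
  by rewrite xA // !mul0r.
rewrite ltNge; apply/negP => h.
(* All the weight of [v] moves to [u]: the first variation vanishes and the second is nonpositive,
   so the value stays below [c] on a smaller set. *)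
apply: (dropF (sh u v (x v)) v vA).
- apply: shS => //; have := x_ge0 u; have := x_ge0 v; lra.
- by rewrite /sh eqxx eq_sym (negPf uv) /=; lra.
- rewrite /sh qform_shift (L_eq _ _ uA vA) subrr mulr0 addr0.
  apply: le_lt_trans xc; rewrite gerDl mulr_ge0_le0 ?sqr_ge0 //; lra.
Qed.

End QuadraticForm.

(** * Coloured complete graphs without an embedding *)

(* Colours of pairs and of vertices: [None] is gray, [Some false] white and
   [Some true] black. *)
Definition compat (b : bool) (c : option bool) : bool := c != Some (~~ b).

(** [phi] need not be injective: vertices with a common image are tested against its diagonal
    colour. *)
Definition embeds (h : nat) (a : rel 'I_h) (T : Type) (K : T -> T -> option bool) :=
  exists phi : 'I_h -> T, forall i j, i != j -> compat (a i j) (K (phi i) (phi j)).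

(** Edit density forced on a pair of parts of a graph of density $p$: all edges are deleted, all
    non-edges are added, or nothing is forced. *)
Definition cost (R : realType) (p : R) (c : option bool) : R :=
  match c with None => 0 | Some false => p | Some true => 1 - p end.

(* [a] embeds into every coloured complete graph on [m] vertices whose white
   vertices are given by [white], which has no black pair and in which the
   pairs related by [gray] are gray. *)
Definition template (h : nat) (a : rel 'I_h) (m : nat) (white : pred nat) (gray : rel nat) :=
  exists tau : 'I_h -> nat, (forall i, (tau i < m)%N) /\
    forall i j, i != j ->
      if tau i == tau j then a i j != white (tau i)
      else gray (tau i) (tau j) || ~~ a i j.

Lemma template_embeds (h : nat) (a : rel 'I_h) (m : nat) white gray
    (T : Type) (K : T -> T -> option bool) (s : nat -> T) :
  template a m white gray ->
  (forall i, (i < m)%N -> K (s i) (s i) = Some (~~ white i)) ->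
  (forall i j, (i < m)%N -> (j < m)%N -> i != j ->
     K (s i) (s j) <> Some true /\ (gray i j -> K (s i) (s j) = None)) ->
  embeds a K.
Proof.
move=> [tau [tau_lt tauP]] Kd Ko; exists (s \o tau) => i j ij /=.
have := tauP _ _ ij; case: eqP => [<-|/eqP tij].
  by rewrite Kd //; case: (a i j); case: (white _).
have [K1 K2] := Ko _ _ (tau_lt i) (tau_lt j) tij.
case/orP=> [/K2->//|/negbTE->].
by apply/eqP.
Qed.

(** Stated on naturals, so that properties of a given cycle can be decided by computation. *)
Definition cyc (h i j : nat) : bool := ((i.+1 %% h)%N == j) || ((j.+1 %% h)%N == i).

(** The three configurations that the lower bound excludes: two white vertices in a gray pair, a
    white vertex gray to four black ones, and six black vertices around a gray hexagon. *)
Definition richly_contractible (h : nat) (a : rel 'I_h) :=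
  [/\ template a 2 xpredT (fun _ _ => true),
      template a 5 (pred1 0%N) (fun i j => (i == 0%N) || (j == 0%N)) &
      template a 6 xpred0 (cyc 6)].

(** * Hexagons in vertex-weighted graphs of large weighted degree *)

Section Hexagon.
Variables (R : realType) (T : finType) (A : {set T}) (e : rel T) (x : T -> R) (mu : R).
Hypotheses (e_sym : symmetric e) (e_irr : irreflexive e).
Hypotheses (mu_gt0 : 0 < mu) (mu_lt : 9 * mu < 1).
Hypotheses (x_gt0 : forall i, i \in A -> 0 < x i) (x_sum : \sum_(i in A) x i = 1).
Let deg i := \sum_(j in A | e i j) x j.
Hypothesis deg_gt : forall i, i \in A -> 3 * mu + (mu^-1 - 4) * x i < deg i.

(* Double count the weight of the pairs (j, w) with v ~ j ~ w, where v has
   maximal weight.  If w has at least four common neighbours with v then in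
   the absence of a hexagon no neighbour of w and v is adjacent to another
   such vertex, so that these w contribute little. *)
Lemma hexagon : exists2 s : seq T, size s = 6%N &
  [/\ uniq s, {subset s <= A} & cycle e s].
Proof.
case: (pselect (exists2 s : seq T, size s = 6%N &
  [/\ uniq s, {subset s <= A} & cycle e s])) => // nohex; exfalso.
have [i0 i0A] : exists i, i \in A.
  apply/existsP; apply: contraPT x_sum; rewrite negb_exists => /forallP A0.
  by rewrite big1 => [/esym/eqP|i iA]; [rewrite oner_eq0|have := A0 i; rewrite iA].
case: (@Order.TotalTheory.arg_maxP _ _ _ i0 (mem A) x i0A) => v vA vmax.
set m := x v in vmax.
have c_gt : 9 < mu^-1.
  by rewrite -(@ltr_pM2r _ mu) // mulVf ?gt_eqF.
have cmu : mu^-1 * mu = 1 by rewrite mulVf ?gt_eqF.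
have dgt := deg_gt; set c := mu^-1 in c_gt cmu dgt.
have m_gt0 : 0 < m by exact: x_gt0.
(* The weight of [v] and of its neighbours is at most 1, so $(c-3)m < 1 - 3\mu = (c-3)\mu$. *)
have m_lt : m < mu.
  have : m + deg v <= 1.
    rewrite -x_sum (bigD1 v) //= lerD2l [leRHS](bigID (e v)) /=.
    have -> : deg v = \sum_(i in A | (i != v) && e v i) x i.
      by apply: eq_bigl => i; case: eqP => [->|]; rewrite ?e_irr ?andbF.
    under [X in _ <= X + _]eq_bigl do rewrite -andbA.
    by rewrite lerDl sumr_ge0 // => i /andP[/andP[iA _] _]; exact/ltW/x_gt0.
  move=> h; have := dgt _ vA; rewrite -/m => h'.
  have : (c - 3) * m < (c - 3) * mu by rewrite [in ltRHS]mulrBl cmu; lra.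
  by rewrite ltr_pM2l //; lra.
pose N := [set j in A | e v j]%SET.
pose codeg w := #|[set j in N | e j w]%SET|.
have NA j : j \in N -> j \in A by rewrite inE => /andP[].
(* Four common neighbours are what the hexagon v, j1, w, j, w', j2 takes: the last choice j2, a
   common neighbour of v and w', has to avoid j, j1 and w. *)
pose big w := (w != v) && (3 < codeg w)%N.
have big_uniq j w w' : j \in N -> w \in A -> w' \in A -> e j w -> e j w' ->
    big w -> big w' -> w = w'.
  move=> jN wA w'A jw jw' /andP[wv bw] /andP[w'v bw'].
  have [//|ww'] := eqVneq w w'; exfalso; apply: nohex.
  have pick (B D : {set T}) : (#|D| < #|B|)%N -> exists2 y, y \in B & y \notin D.
    move=> DB; apply/exists_inP; apply: contraTT DB.
    rewrite negb_exists_in -leqNgt => /forall_inP BD.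
    by apply/subset_leq_card/fintype.subsetP => y /BD; rewrite negbK.
  have [|j1 j1w] := pick [set j in N | e j w]%SET [set j; w']%SET.
    by rewrite (leq_ltn_trans _ bw) // cards2; case: eqP.
  rewrite !inE negb_or => /andP[j1j j1w'].
  have [|j2 j2w] := pick [set j in N | e j w']%SET (j1 |: [set j; w])%SET.
    rewrite (leq_ltn_trans _ bw') // (leq_trans (leq_card_setU _ _)) //.
    by rewrite cards1 cards2; case: eqP.
  rewrite !inE !negb_or => /and3P[j2j1 j2j j2w'].
  move: j1w j2w jN; rewrite !inE => /andP[/andP[j1A vj1] j1w] /andP[/andP[j2A vj2] j2w].
  move=> /andP[jA vj].
  have ne y z : e y z -> y != z by apply: contraTneq => ->; rewrite e_irr.
  exists [:: v; j1; w; j; w'; j2] => //; split.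
  - rewrite /= !inE !negb_or (ne _ _ vj1) (ne _ _ vj) (ne _ _ vj2) (ne _ _ j1w).
    rewrite (eq_sym v w) wv (eq_sym v w') w'v j1j j1w' (eq_sym j1 j2) j2j1.
    rewrite (eq_sym w j) (ne _ _ jw) ww' (eq_sym w j2) j2w' (ne _ _ jw') (eq_sym j j2) j2j.
    by rewrite (eq_sym w' j2) (ne _ _ j2w).
  - by move=> y; rewrite !inE => /or4P[| | |/or3P[]] /eqP->.
  - by rewrite /= vj1 j1w (e_sym w) jw jw' (e_sym w') j2w (e_sym j2) vj2.
have degv : deg v <= m *+ #|N|.
  rewrite -sumr_const; have -> : deg v = \sum_(j in N) x j.
    by apply: eq_bigl => j; rewrite inE.
  by apply: ler_sum => j /NA; exact: vmax.
have S_lb : 3 * mu *+ #|N| + (c - 4) * deg v <= \sum_(j in N) deg j.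
  have -> : deg v = \sum_(j in N) x j by apply: eq_bigl => j; rewrite inE.
  rewrite -sumr_const mulr_sumr -big_split /=.
  by apply: ler_sum => j /NA /dgt/ltW.
(* By exchange the sum is that of [codeg w * x w]. The vertex [v] contributes [m] times the size of
   [N]. The other vertices of codegree at most 3 contribute at most $3(1-m)$. Each [j] in [N] sees
   at most one big vertex, of weight at most [m]. *)
have S_ub : \sum_(j in N) deg j <= (m + m) *+ #|N| + 3 * (1 - m).
  have dE j : deg j = \sum_(w in A) (e j w)%:R * x w.
    rewrite /deg big_mkcondr; apply: eq_bigr => w _.
    by case: (e j w); rewrite ?mul1r ?mul0r.
  have -> : \sum_(j in N) deg j = \sum_(w in A) (codeg w)%:R * x w.
    rewrite (eq_bigr _ (fun j _ => dE j)) exchange_big /=; apply: eq_bigr => w _.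
    rewrite -mulr_suml; congr (_ * _); rewrite /codeg -sum1_card natr_sum.
    rewrite big_mkcond [RHS]big_mkcond; apply: eq_bigr => j _.
    by rewrite !inE; case: (j \in A) => //=; case: (e v j) => //=; case: (e j w).
  have bnd w : w \in A -> (codeg w)%:R * x w <=
      (w == v)%:R * (m *+ #|N|) + ((big w)%:R * (codeg w)%:R * x w + 3 * ((w != v)%:R * x w)).
    move=> wA; have [->|wv] /= := eqVneq w v.
            rewrite /big eqxx /= !mul0r !mulr0 mul1r !addr0 -/m.
      suff -> : codeg v = #|N| by rewrite mulr_natl.
      by apply: eq_card => j; rewrite !inE (e_sym j v) -andbA andbb.
    rewrite /big wv /=; have xw := x_gt0 wA.
    case: ltnP => [_|h]; rewrite ?mul0r ?mul1r ?add0r.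
      by rewrite lerDl mulr_ge0 // ltW.
    by apply: ler_wpM2r; [exact: ltW | rewrite (ler_nat _ _ 3)].
  apply: le_trans (ler_sum _ bnd) _; rewrite !big_split /= -!mulr_sumr.
  have -> : \sum_(i in A) (i == v)%:R * (m *+ #|N|) = m *+ #|N|.
    rewrite (bigD1 v) //= eqxx mul1r big1 ?addr0 // => i /andP[_ /negPf->].
    by rewrite mul0r.
  have -> : \sum_(i in A) (i != v)%:R * x i = 1 - m.
    rewrite -[X in _ = X - m]x_sum (bigD1 v) //= eqxx mul0r add0r [in RHS](bigD1 v) //=.
    rewrite -/m addrAC subrr add0r; apply: eq_bigr => i /andP[_ iv].
    by rewrite iv mul1r.
  rewrite mulrnDl -addrA lerD2l lerD2r.
  have -> : \sum_(w in A) (big w)%:R * (codeg w)%:R * x w =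
      \sum_(j in N) \sum_(w in A | big w && e j w) x w.
    under [RHS]eq_bigr do rewrite big_mkcondr.
    rewrite exchange_big /=; apply: eq_bigr => w _.
    case: (big w); rewrite ?mul0r /= ?big1_eq // mul1r.
    rewrite -big_mkcondr sumr_const mulr_natl; congr (_ *+ _).
    by rewrite /codeg; apply: eq_card => j; rewrite inE.
  rewrite -sumr_const; apply: ler_sum => j jN.
  case: (pickP (fun w => [&& w \in A, big w & e j w])) => [w /and3P[wA bw jw]|none].
    rewrite (big_pred1 w); first exact: vmax.
    move=> w'; apply/idP/eqP.
      by move=> /and3P[w'A bw' jw']; apply: (big_uniq j).
    by move=> ->; rewrite wA bw.
  by rewrite big_pred0 ?ltW // => w; rewrite none.
have dv := dgt _ vA; rewrite -/m in dv.
set d := deg v in degv S_lb dv.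
rewrite -mulr_natr in degv; rewrite -mulr_natr in S_lb.
rewrite -mulr_natr in S_ub; set k := #|N|%:R in degv S_lb S_ub.
have h1 : (3 * mu - 2 * m) * k + (c - 4) * d <= 3 * (1 - m) by lra.
(* Multiply by [m] and eliminate [k] through [d <= m * k]; its coefficient $3\mu - 2m$ is positive
   because $m < \mu$. *)
have h2 : (3 * mu - 2 * m) * d + m * (c - 4) * d <= 3 * m * (1 - m).
  have h3 := ler_wpM2l (ltW m_gt0) h1.
  have : (3 * mu - 2 * m) * d <= (3 * mu - 2 * m) * (m * k).
    by apply: ler_wpM2l => //; lra.
  by move: h3; rewrite mulrDr !mulrA !(mulrC m); lra.
(* Normalization $m = \mu y$ with $0 < y < 1$, after which $\mu^2$ can be divided out. *)
pose y := m * c.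
have my : m = mu * y by rewrite /y mulrC -mulrA cmu mulr1.
have y0 : 0 < y by rewrite mulr_gt0 //; lra.
have y1 : y < 1 by rewrite -(ltr_pM2l mu_gt0) -my mulr1.
have f_gt0 : 0 < 3 * mu - 2 * m + m * (c - 4).
  by rewrite addr_gt0 ?mulr_gt0 //; lra.
have h4 : (3 * mu + (c - 4) * m) * (3 * mu - 2 * m + m * (c - 4)) < 3 * m * (1 - m).
  apply: lt_le_trans h2; rewrite -mulrDl mulrC ltr_pM2l //.
have : (3 + (c - 4) * y) * (3 - 2 * y + y * (c - 4)) < 3 * y * (c - y).
  rewrite -(@ltr_pM2l _ (mu * mu)) ?mulr_gt0 //.
  rewrite my in h4.
  have -> : mu * mu * (3 * y * (c - y)) = 3 * (mu * y) * (1 - mu * y).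
    by rewrite -cmu; ring.
  by apply: le_lt_trans h4; rewrite le_eqVlt; apply/orP; left; apply/eqP; ring.
have yc : 0 <= (c - 9) * y by rewrite mulr_ge0 //; lra.
have yy : 0 <= y * y by rewrite mulr_ge0 // ltW.
have ycc : 0 <= ((c - 4) * (c - 6) + 3) * (y * y).
  by rewrite mulr_ge0 // addr_ge0 // mulr_ge0; lra.
(* The left side exceeds the right: in this form $9 - 3y$ is positive, and the remaining terms are
   nonnegative since $c > 9$. *)
have -> : (3 + (c - 4) * y) * (3 - 2 * y + y * (c - 4)) =
  3 * y * (c - y) + (9 + 3 * ((c - 9) * y) - 3 * y + ((c - 4) * (c - 6) + 3) * (y * y)) by ring.
lra.
Qed.

End Hexagon.

(* In a minimal support there are no black pairs and all pairs of white
   vertices are gray. *)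
Lemma embedding_free_bound (R : realType) (n h : nat) (a : rel 'I_h)
    (K : 'I_n -> 'I_n -> option bool) (p : R) (x0 : 'I_n -> R) :
  richly_contractible a -> (forall i j, K i j = K j i) ->
  (forall i, K i i != None) -> 0 < p -> 7 * p < 1 ->
  (forall i, 0 <= x0 i) -> \sum_i x0 i = 1 -> ~ embeds a K ->
  p * (1 - p) / (1 + 2 * p) <= qform (fun i j => cost p (K i j)) x0.
Proof.
move=> [aWW aW aB] symK diagK p_gt0 p_lt x0_ge0 x0_sum noembed.
rewrite leNgt; apply/negP => lt_g.
set M := fun i j => cost p (K i j) in lt_g.
have symM i j : M i j = M j i by rewrite /M symK.
have [A [x [[x_ge0 x_sum xA] x_gt0 g_lt first second]]] :=
  qform_core symM x0_ge0 x0_sum lt_g.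
set g := qform M x in g_lt first.
have costP c : 0 <= cost p c by case: c => [[]|] /=; lra.
have g_lt' : g * (1 + 2 * p) < p * (1 - p) by rewrite -ltr_pdivlMr //; lra.
have Kdiag i : K i i = Some true \/ K i i = Some false.
  by move: (diagK i); case: (K i i) => [[]|]; [left|right|].
(* A black pair costs $1-p$, which is at least the mean of any two diagonal costs because $p < 1/2$;
   this violates the strict second-order condition. *)
have noblack u v : u \in A -> v \in A -> u != v -> K u v <> Some true.
  move=> uA vA uv Kuv; have := second _ _ uA vA uv; rewrite /M Kuv /=.
  by case: (Kdiag u) => ->; case: (Kdiag v) => -> /=; lra.
have row_ge u (B : {set 'I_n}) : u \in A -> \sum_(j in B) x j * M u j <= g.
  move=> uA; rewrite -(first _ uA) [leRHS](bigID (mem B)) /= lerDl.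
  by apply: sumr_ge0 => i _; apply: mulr_ge0; [exact: x_ge0|exact: costP].
have [/exists_inP[u uA /eqP Ku]|] := boolP [exists u in A, K u u == Some false].
  have black v : v \in A -> v != u -> K v v = Some true.
    move=> vA vu; case: (Kdiag v) => // Kv; exfalso; apply: noembed.
    apply: (template_embeds (s := fun i => if i == 0%N then u else v) aWW) => [|i j].
      by case.
    move=> ilt jlt ij; have Kuv : K u v = None.
      have uv : u != v by rewrite eq_sym.
      move: (noblack _ _ uA vA uv) (second _ _ uA vA uv); rewrite /M Ku Kv.
      by case: (K u v) => [[]|] //= _ ?; exfalso; lra.
    have Kvu : K v u = None by rewrite symK.
    by case: i j ij ilt jlt => [|[|i]] [|[|j]] //= _ _ _; rewrite ?Kuv ?Kvu.
  pose B := [set v in A | (v != u) && (K u v == None)]%SET.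
  have few : (#|B| <= 3)%N.
    rewrite leqNgt; apply/negP => B4; apply: noembed.
    pose s i := if i is j.+1 then nth u (enum B) j else u.
    have sB i : (i < 4)%N -> s i.+1 \in B.
      by move=> i4; rewrite -mem_enum mem_nth // -cardE (leq_trans i4).
    apply: (template_embeds (s := s) aW) => [[|i]|i j] ilt /=.
    - by rewrite Ku.
    - by have := sB i ilt; rewrite inE => /and3P[iA iu _]; rewrite black.
    - case: i j ilt => [|i] [|j] // ilt jlt ij.
      + by have := sB j jlt; rewrite inE => /and3P[_ _ /eqP] ->.
      + by have := sB i ilt; rewrite inE symK => /and3P[_ _ /eqP] ->.
      + split=> //; apply: noblack.
        * by have := sB i ilt; rewrite inE => /andP[].
        * by have := sB j jlt; rewrite inE => /andP[].
        * rewrite nth_uniq ?enum_uniq // -cardE (leq_trans _ B4) //.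
  (* Lagrange's condition at the white vertex [u]: its row costs [p] except on the gray neighbours
     [B]. The condition at each black neighbour gives $x_j(1-p) \le g$. With at most three
     neighbours, $(p-g)(1-p) \le 3pg$, which is the claimed bound. *)
  have gu : g = p * (1 - \sum_(j in B) x j).
    rewrite -(first _ uA) -x_sum [in RHS](bigID (mem B)) /= [X in p * X]addrAC.
    rewrite subrr add0r (bigID (mem B)) /= big1 ?add0r => [|j].
      rewrite mulr_sumr; apply: eq_bigr => j jB; rewrite mulrC.
      have [jA|jA] := boolP (j \in A); last by rewrite xA // !mulr0.
      congr (_ * _); rewrite /M; have [->|ju] := eqVneq j u; first by rewrite Ku.
      have := noblack _ _ uA jA; rewrite eq_sym ju => /(_ isT).
      move: jB; rewrite !inE jA ju /=.
      by case: (K u j) => [[]|] //=.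
    by rewrite inE => /and3P[_ _ /eqP Kuj]; rewrite /M Kuj mulr0.
  have xB : \sum_(j in B) x j * (1 - p) <= g *+ #|B|.
    rewrite -sumr_const; apply: ler_sum => j; rewrite inE => /and3P[jA ju _].
    have := row_ge j [set j]%SET jA; rewrite big_set1 /M black //.
  rewrite -mulr_suml in xB; set b := \sum_(j in B) x j in gu xB.
  have g_ge0 : 0 <= g by apply: le_trans (row_ge u finset.set0 uA); rewrite big_set0.
  have gB : g * #|B|%:R <= g * 3 by rewrite ler_wpM2l // (ler_nat _ _ 3).
  rewrite -(mulr_natr g) in xB.
  have : p * (b * (1 - p)) <= p * (g * 3) by rewrite ler_pM2l //; lra.
  have -> : p * (b * (1 - p)) = (p - g) * (1 - p) by rewrite gu; ring.
  lra.
rewrite negb_exists_in => /forall_inP allblack.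
have Kb i : i \in A -> K i i = Some true.
  by case: (Kdiag i) => // Ki /allblack; rewrite Ki.
pose e : rel 'I_n := fun i j => K i j == None.
(* Lagrange's condition reads $\deg i = 1 - g/p + (1/p - 2) x_i$. For this [mu], failure of the
   bound means $1 - g/p > 3\mu$, and $1/p - 2 = \mu^{-1} - 4$. *)
pose mu := p / (1 + 2 * p).
have mu_gt0 : 0 < mu by rewrite divr_gt0 //; lra.
have muV : mu^-1 = p^-1 + 2 by rewrite /mu; field; lra.
have [||||||i iA|s s6 [us sA cs]] := @hexagon R 'I_n A e x mu.
- by move=> i j; rewrite /e symK.
- by move=> i; exact: negbTE (diagK i).
- by [].
- by rewrite /mu mulrA ltr_pdivrMr; lra.
- by [].
- by rewrite -x_sum [RHS](bigID (mem A)) /= [X in _ = _ + X]big1 ?addr0.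
- have row : g = p + (1 - 2 * p) * x i - p * \sum_(j in A | e i j) x j.
    have xi : \sum_j (j == i)%:R * x j = x i.
      by rewrite (bigD1 i) //= eqxx mul1r big1 ?addr0 // => j /negPf->; rewrite mul0r.
    have di : \sum_j (K i j == None)%:R * x j = \sum_(j in A | e i j) x j.
      rewrite [RHS]big_mkcond; apply: eq_bigr => j _; rewrite /e.
      have [jA|jA] := boolP (j \in A); last by rewrite xA // mulr0.
      by case: eqP; rewrite ?mul1r ?mul0r.
    have -> : p + (1 - 2 * p) * x i - p * \sum_(j in A | e i j) x j = \sum_j
        (p * x j + (1 - 2 * p) * ((j == i)%:R * x j) - p * ((K i j == None)%:R * x j)).
      by rewrite sumrB big_split /= -!mulr_sumr xi di x_sum mulr1.
    rewrite -(first _ iA).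
    apply: eq_bigr => j _.
    have [jA|jA] := boolP (j \in A); last by rewrite xA //; ring.
    rewrite /M; have [->|ji] := eqVneq j i; first by rewrite Kb //=; ring.
    have := noblack _ _ iA jA; rewrite eq_sym ji => /(_ isT).
    by case: (K i j) => [[]|] //= _; ring.
  have pmu : mu * (1 + 2 * p) = p by rewrite /mu; field; lra.
  rewrite -(ltr_pM2l p_gt0) muV.
  have -> : p * (3 * mu + (p^-1 + 2 - 4) * x i) = 3 * p * mu + (1 - 2 * p) * x i.
    by field; lra.
  have : g < p - 3 * p * mu.
    rewrite -(@ltr_pM2r _ (1 + 2 * p)); last lra.
    have -> : (p - 3 * p * mu) * (1 + 2 * p) = p * (1 + 2 * p) - 3 * p * (mu * (1 + 2 * p)).
      by ring.
    by apply: lt_le_trans g_lt' _; rewrite pmu; lra.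
  by rewrite row; lra.
apply: noembed.
have [i0 _] : exists i0, i0 \in s by case: s s6 {us sA cs} => // i0 s _; exists i0; rewrite inE eqxx.
apply: (template_embeds (s := nth i0 s) aB) => [i ilt|i j ilt jlt ij].
  by rewrite Kb //; apply: sA; rewrite mem_nth // s6.
split.
  by apply: noblack; rewrite ?nth_uniq ?s6 //; apply: sA; rewrite mem_nth // s6.
move: cs s6 {us sA}; case: s => [|s0 [|s1 [|s2 [|s3 [|s4 [|s5 [|]]]]]]] //=.
rewrite /e => /and5P[/eqP e0 /eqP e1 /eqP e2 /eqP e3 /and3P[/eqP e4 /eqP e5 _]] _.
case: i j ilt jlt {ij} => [|[|[|[|[|[|i]]]]]] [|[|[|[|[|[|j]]]]]] //= _ _ _.
all: by rewrite symK.
Qed.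

(** * Adjacency in cycles and the templates for $C_{10}$ and $C_{12}$ *)

Lemma pair_set_eq (T : finType) (x y a b : T) : a != b ->
  [set x; y]%SET = [set a; b]%SET -> (x = a /\ y = b) \/ (x = b /\ y = a).
Proof.
move=> ab exy.
have xe : x \in [set a; b]%SET by rewrite -exy !inE eqxx.
have ye : y \in [set a; b]%SET by rewrite -exy !inE eqxx orbT.
have ae : a \in [set x; y]%SET by rewrite exy !inE eqxx.
have be : b \in [set x; y]%SET by rewrite exy !inE eqxx orbT.
move: xe ye; rewrite !inE => /orP[] /eqP ex /orP[] /eqP ey; auto.
  by move: be ab; rewrite ex ey !inE orbb eq_sym => ->.
by move: ae ab; rewrite ex ey !inE orbb => ->.
Qed.

Lemma adj_C (h : nat) (i j : 'I_h) : (2 < h)%N -> adj (C_ h) i j = cyc h i j.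
Proof.
move=> h2; apply/imsetP/orP => [[k]|].
  rewrite inE => kk E; have [[-> ->]|[-> ->]] := pair_set_eq kk E.
    by left.
  by right.
have noloop (k : 'I_h) : k != ordS k.
  rewrite -val_eqE /=; have := ltn_ord k; rewrite leq_eqVlt => /orP[/eqP kh|kh].
    by rewrite kh modnn -lt0n -ltnS kh; apply: leq_trans h2.
  by rewrite modn_small // neq_ltn ltnSn.
case=> /eqP E; [exists i | exists j]; rewrite ?inE ?noloop //.
  by congr [set i; _]%SET; apply: val_inj.
by rewrite finset.setUC; congr [set j; _]%SET; apply: val_inj.
Qed.

Lemma template_C (h m : nat) (tau : seq nat) (white : pred nat) (gray : rel nat) :
  (2 < h)%N ->
  all (fun i => nth 0%N tau i < m)%N (iota 0 h) ->
  all (fun i => all (fun j => (i == j) ||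
     (if nth 0%N tau i == nth 0%N tau j then cyc h i j != white (nth 0%N tau i)
      else gray (nth 0%N tau i) (nth 0%N tau j) || ~~ cyc h i j))
     (iota 0 h)) (iota 0 h) ->
  template (adj (C_ h)) m white gray.
Proof.
move=> h2 /allP tlt /allP tP; exists (nth 0%N tau); split=> [i|i j ij].
  by apply: tlt; rewrite mem_iota add0n ltn_ord.
have iI (k : 'I_h) : nat_of_ord k \in iota 0 h by rewrite mem_iota add0n ltn_ord.
have /allP/(_ _ (iI j)) := tP _ (iI i).
by rewrite adj_C // val_eqE (negPf ij).
Qed.

(** Two white classes: the proper 2-colouring of an even cycle. One white class: four pairwise
    nonadjacent vertices leave arcs of 2, 2, 1 and 1 vertices, each a clique. Hexagon: consecutive
    arcs of 2, 2, 2, 2, 1 and 1 vertices. For $C_{12}$ all these arcs have two vertices. *)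
Lemma C10_richly_contractible : richly_contractible (adj (C_ 10)).
Proof.
split.
- by apply: (@template_C 10 2 [:: 0; 1; 0; 1; 0; 1; 0; 1; 0; 1]%N); vm_compute.
- by apply: (@template_C 10 5 [:: 0; 1; 1; 0; 2; 2; 0; 3; 0; 4]%N); vm_compute.
- by apply: (@template_C 10 6 [:: 0; 0; 1; 1; 2; 2; 3; 3; 4; 5]%N); vm_compute.
Qed.

Lemma C12_richly_contractible : richly_contractible (adj (C_ 12)).
Proof.
split.
- by apply: (@template_C 12 2 [:: 0; 1; 0; 1; 0; 1; 0; 1; 0; 1; 0; 1]%N); vm_compute.
- by apply: (@template_C 12 5 [:: 0; 1; 1; 0; 2; 2; 0; 3; 3; 0; 4; 4]%N); vm_compute.
- by apply: (@template_C 12 6 [:: 0; 0; 1; 1; 2; 2; 3; 3; 4; 4; 5; 5]%N); vm_compute.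
Qed.

(** * Weak regularity and counting *)

Section Averages.
Variable R : realType.
Implicit Types T : finType.

Definition avg T (F : T -> R) : R := (\sum_x F x) / #|T|%:R.

Lemma eq_avg T (F G : T -> R) : F =1 G -> avg F = avg G.
Proof. by move=> FG; rewrite /avg (eq_bigr _ (fun x _ => FG x)). Qed.

Lemma ler_avg T (F G : T -> R) : (forall x, F x <= G x) -> avg F <= avg G.
Proof. by move=> FG; rewrite ler_wpM2r ?invr_ge0 // ler_sum. Qed.

Lemma avg_ge0 T (F : T -> R) : (forall x, 0 <= F x) -> 0 <= avg F.
Proof. by move=> F0; rewrite divr_ge0 ?sumr_ge0. Qed.

Lemma avgD T (F G : T -> R) : avg (fun x => F x + G x) = avg F + avg G.
Proof. by rewrite /avg big_split mulrDl. Qed.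

Lemma avgB T (F G : T -> R) : avg (fun x => F x - G x) = avg F - avg G.
Proof. by rewrite /avg sumrB mulrBl. Qed.

Lemma avgZ T c (F : T -> R) : avg (fun x => c * F x) = c * avg F.
Proof. by rewrite /avg -mulr_sumr mulrA. Qed.

Lemma avg_sum T (I : finType) (P : pred I) (F : I -> T -> R) :
  avg (fun x => \sum_(i | P i) F i x) = \sum_(i | P i) avg (F i).
Proof. by rewrite /avg exchange_big mulr_suml. Qed.

Lemma avg_cst T (c : R) : (0 < #|T|)%N -> avg (fun _ : T => c) = c.
Proof.
by move=> T0; rewrite /avg sumr_const -(mulr_natr c) mulfK // pnatr_eq0 -lt0n.
Qed.

Lemma avg_cst_le T (c : R) : 0 <= c -> avg (fun _ : T => c) <= c.
Proof.
move=> c0; case: (posnP #|T|) => [T0|/avg_cst-> //].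
by rewrite /avg T0 invr0 mulr0.
Qed.

Lemma ler_norm_avg T (F : T -> R) : `|avg F| <= avg (fun x => `|F x|).
Proof.
rewrite /avg normrM (@ger0_norm _ (_^-1)) ?invr_ge0 //.
by rewrite ler_wpM2r ?invr_ge0 // ler_norm_sum.
Qed.

Lemma avg_norm_le T (F : T -> R) c : 0 <= c -> (forall x, `|F x| <= c) -> `|avg F| <= c.
Proof.
move=> c0 Fc; apply: le_trans (ler_norm_avg F) (le_trans (ler_avg Fc) _).
exact: avg_cst_le.
Qed.

Lemma exchange_avg T T' (F : T -> T' -> R) :
  avg (fun x => avg (F x)) = avg (fun y => avg (F^~ y)).
Proof.
rewrite /avg -!mulr_suml exchange_big /= -!mulrA; congr (_ * _).
by rewrite mulrC.
Qed.

(* [get] reads part of [z] and [rep] overwrites it, so drawing [z] uniformly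
   and then redrawing that part still yields a uniform [z]. *)
Lemma avg_resample T T' (rep : T -> T' -> T) (get : T -> T') (F : T -> R) :
  (0 < #|T'|)%N -> (forall z x, rep (rep z x) (get z) = z) ->
  (forall z x, get (rep z x) = x) ->
  avg (fun z => avg (fun x => F (rep z x))) = avg F.
Proof.
move=> T'0 repK getK; rewrite -(avg_cst (avg F) T'0).
rewrite -[RHS](exchange_avg (fun z _ => F z)) /avg -!mulr_suml; congr (_ / _ / _).
rewrite !pair_big /=.
(* Exchanging the old part with the newly drawn one is an involution of the product space. *)
pose swap zx : T * T' := (rep zx.1 zx.2, get zx.1).
have swapK : involutive swap by move=> [z x]; rewrite /swap /= repK getK.
by rewrite [RHS](reindex_inj (inv_inj swapK)).
Qed.

Definition upd (I : finType) T (z : {ffun I -> T}) (i : I) (x : T) : {ffun I -> T} :=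
  [ffun j => if j == i then x else z j].

Lemma avg_upd (I : finType) T (i : I) (F : {ffun I -> T} -> R) : (0 < #|T|)%N ->
  avg (fun z => avg (fun x => F (upd z i x))) = avg F.
Proof.
move=> T0; apply: (avg_resample (rep := fun z => upd z i) (get := fun z => z i)) => // z x.
  by apply/ffunP => j; rewrite !ffunE; case: eqP => // ->.
by rewrite ffunE eqxx.
Qed.

Lemma avg_prod (I : finType) T (g : T -> R) :
  avg (fun u : {ffun I -> T} => \prod_i g (u i)) = avg g ^+ #|I|.
Proof.
rewrite /avg card_ffun expr_div_n natrX; congr (_ / _).
by rewrite -(bigA_distr_bigA (fun _ x => g x)) prodr_const.
Qed.

(** A convex power lies above its tangent at [a]; averaging the tangent at the mean gives Jensen's
    inequality below. *)
Lemma tangent_le (a b : R) (t : nat) : 0 <= a -> 0 <= b ->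
  a ^+ t + t%:R * a ^+ t.-1 * (b - a) <= b ^+ t.
Proof.
move=> a0 b0; elim: t => [|[|t] IH]; first by rewrite !expr0; lra.
  by rewrite !expr1 expr0; lra.
rewrite [leRHS]exprS (le_trans _ (ler_wpM2l b0 IH)) // -subr_ge0 /=.
set n := t.+1%:R; have -> : t.+2%:R = n + 1 :> R by rewrite /n -[in LHS]addn1 natrD.
have -> : b * (a ^+ t.+1 + n * a ^+ t * (b - a)) -
    (a ^+ t.+2 + (n + 1) * a ^+ t.+1 * (b - a)) = n * a ^+ t * (b - a) ^+ 2.
  by rewrite !exprS; ring.
by rewrite mulr_ge0 ?sqr_ge0 // mulr_ge0 ?exprn_ge0 // ler0n.
Qed.

Lemma jensen_avg T (b : T -> R) (t : nat) : (0 < #|T|)%N -> (forall x, 0 <= b x) ->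
  avg b ^+ t <= avg (fun x => b x ^+ t).
Proof.
move=> T0 b0; have a0 := avg_ge0 b0.
have := ler_avg (fun x => tangent_le t a0 (b0 x)).
by rewrite avgD avgZ avgB !avg_cst // subrr mulr0 addr0.
Qed.

Lemma sum_sqr_ge (I : finType) (u : I -> R) :
  (\sum_i u i) ^+ 2 <= #|I|%:R * \sum_i u i ^+ 2.
Proof.
have [I0|I0] := posnP #|I|.
  by rewrite I0 mul0r big_pred0 ?expr0n // => i; move/card0_eq: I0 => /(_ i).
have n0 : 0 < #|I|%:R :> R by rewrite ltr0n.
set n := #|I|%:R in n0 *; set s := \sum_i u i.
have : 0 <= \sum_i (n * u i - s) ^+ 2 by apply: sumr_ge0 => i _; rewrite sqr_ge0.
have -> : \sum_i (n * u i - s) ^+ 2 = n * (n * (\sum_i u i ^+ 2) - s ^+ 2).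
  under eq_bigr do rewrite sqrrB exprMn.
  rewrite big_split sumrB /= -mulr_sumr sumr_const -mulr_natl -/n.
  have -> : \sum_i n * u i * s *+ 2 = 2 * n * s * s.
    rewrite -[in X in _ = _ * X]/(\sum_i u i) mulr_sumr.
    by apply: eq_bigr => i _; rewrite -mulr_natr; ring.
  by ring.
by rewrite pmulr_rge0 // subr_ge0.
Qed.

End Averages.

Section WeakRegularity.
Variables (R : realType) (V : finType).
Implicit Types (f D : V -> V -> R) (C : finType).

(** The cut norm of [D], normalized by the square of the number of vertices, is at most [delta]. *)
Definition cut_le D (delta : R) := forall S T : {set V},
  `|\sum_(x in S) \sum_(y in T) D x y| <= delta * #|V|%:R ^+ 2.

Definition block_mean f C (c : V -> C) (a b : C) : R :=
  (\sum_(x | c x == a) \sum_(y | c y == b) f x y)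
  / (#|[pred x | c x == a]|%:R * #|[pred y | c y == b]|%:R).

Definition proj f C (c : V -> C) (x y : V) : R := block_mean f c (c x) (c y).

Lemma sum_blocks C (c : V -> C) (F : V -> V -> R) :
  \sum_x \sum_y F x y =
  \sum_a \sum_b \sum_(x | c x == a) \sum_(y | c y == b) F x y.
Proof.
rewrite (partition_big c xpredT) //=; apply: eq_bigr => a _.
rewrite exchange_big /= [LHS](partition_big c xpredT) //=; apply: eq_bigr => b _.
by rewrite exchange_big.
Qed.

(** [proj] is the conditional expectation on blocks, that is, the orthogonal projection onto
    block-constant kernels. On an empty block the quotient takes the value 0, but the sums over it
    vanish as well. *)
Lemma sum_proj f C (c : V -> C) (h : C -> C -> R) :
  \sum_x \sum_y proj f c x y * h (c x) (c y) =
  \sum_x \sum_y f x y * h (c x) (c y).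
Proof.
rewrite (sum_blocks c) [RHS](sum_blocks c); apply: eq_bigr => a _; apply: eq_bigr => b _.
have -> : \sum_(x | c x == a) \sum_(y | c y == b) f x y * h (c x) (c y) =
   (\sum_(x | c x == a) \sum_(y | c y == b) f x y) * h a b.
  rewrite mulr_suml; apply: eq_bigr => x /eqP->.
  by rewrite mulr_suml; apply: eq_bigr => y /eqP->.
have -> : \sum_(x | c x == a) \sum_(y | c y == b) proj f c x y * h (c x) (c y) =
   #|[pred x | c x == a]|%:R * #|[pred y | c y == b]|%:R * (block_mean f c a b * h a b).
  rewrite -mulrA mulr_natl -sumr_const; apply: eq_bigr => x /eqP xa.
  rewrite mulr_natl -sumr_const; apply: eq_bigr => y /eqP yb.
  by rewrite /proj xa yb.
rewrite mulrA /block_mean; set n1 := #|_|%:R; set n2 := #|_|%:R.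
have [n0|n0] := eqVneq (n1 * n2) 0; last by rewrite mulrCA divff // mulr1.
suff -> : \sum_(x | c x == a) \sum_(y | c y == b) f x y = 0 by rewrite !(mul0r, mulr0).
move/eqP: n0; rewrite mulf_eq0 !pnatr_eq0 => /orP[] /eqP/card0_eq n0.
  by rewrite big_pred0 // => x; exact: n0.
by rewrite big1 // => x _; rewrite big_pred0 // => y; exact: n0.
Qed.

Lemma proj_itv f C (c : V -> C) : (forall x y, 0 <= f x y <= 1) ->
  forall x y, 0 <= proj f c x y <= 1.
Proof.
move=> f01 x y; rewrite /proj /block_mean; set a := c x; set b := c y.
have f0 x' y' : 0 <= f x' y' by case/andP: (f01 x' y').
have n1 : 0 < #|[pred x | c x == a]|%:R :> R by rewrite ltr0n; apply/card_gt0P; exists x; apply/eqP.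
have n2 : 0 < #|[pred x | c x == b]|%:R :> R by rewrite ltr0n; apply/card_gt0P; exists y; apply/eqP.
apply/andP; split.
  apply: divr_ge0; last by rewrite mulr_ge0 // ltW.
  by apply: sumr_ge0 => x' _; apply: sumr_ge0.
rewrite ler_pdivrMr ?mulr_gt0 // mul1r mulr_natl -sumr_const; apply: ler_sum => x' _.
rewrite -sumr_const; apply: ler_sum => y' _.
by case/andP: (f01 x' y').
Qed.

Definition energy f C (c : V -> C) : R := \sum_x \sum_y proj f c x y ^+ 2.

Lemma energy_le f C (c : V -> C) : (forall x y, 0 <= f x y <= 1) ->
  energy f c <= #|V|%:R ^+ 2.
Proof.
move=> f01; rewrite expr2 mulr_natl -sumr_const; apply: ler_sum => x _.
rewrite -sumr_const; apply: ler_sum => y _.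
by have /andP[p0 p1] := proj_itv c f01 x y; rewrite exprn_ile1.
Qed.

(** The indicator of S x T is constant on the blocks of the refinement, so [f] may be replaced there
    by its finer projection. Cauchy-Schwarz bounds the pairing by the squared norm of the difference
    of the projections, which by Pythagoras is the gain in energy. *)
Lemma energy_refine f C (c : V -> C) (S T : {set V}) :
  let c' x := (c x, (x \in S, x \in T)) in
  (\sum_(x in S) \sum_(y in T) (f x y - proj f c x y)) ^+ 2 <=
  #|V|%:R ^+ 2 * (energy f c' - energy f c).
Proof.
pose c' x := (c x, (x \in S, x \in T)); rewrite /= -/c'; pose W := proj f c; pose W' := proj f c'.
pose h (a b : C * (bool * bool)) : R := (a.2.1 && b.2.2)%:R.
have -> : \sum_(x in S) \sum_(y in T) (f x y - proj f c x y) =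
    \sum_x \sum_y (W' x y - W x y) * h (c' x) (c' y).
  have -> : \sum_(x in S) \sum_(y in T) (f x y - proj f c x y) =
      \sum_x \sum_y (f x y - W x y) * h (c' x) (c' y).
    rewrite big_mkcond; apply: eq_bigr => x _ /=.
    rewrite /h /=; case: (x \in S) => /=; last by rewrite big1 // => y; rewrite mulr0.
    rewrite big_mkcond; apply: eq_bigr => y _.
    by case: (y \in T); rewrite ?mulr1 ?mulr0.
  under eq_bigr do (under eq_bigr do rewrite mulrBl; rewrite sumrB).
  under [RHS]eq_bigr do (under eq_bigr do rewrite mulrBl; rewrite sumrB).
  by rewrite !sumrB (sum_proj f c' h).
have -> : energy f c' - energy f c = \sum_x \sum_y (W' x y - W x y) ^+ 2.
  have E : \sum_x \sum_y W' x y * W x y = \sum_x \sum_y W x y * W x y.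
    rewrite (sum_proj f c' (fun a b => block_mean f c a.1 b.1)).
    by rewrite (sum_proj f c (block_mean f c)).
  have -> : \sum_x \sum_y (W' x y - W x y) ^+ 2 =
     \sum_x \sum_y W' x y ^+ 2 + \sum_x \sum_y W x y * W x y - 2 * \sum_x \sum_y W' x y * W x y.
    rewrite mulr_sumr -big_split -sumrB; apply: eq_bigr => x _ /=.
    rewrite mulr_sumr -big_split -sumrB; apply: eq_bigr => y _ /=; ring.
  rewrite E /energy -/W -/W'.
  have -> : \sum_x \sum_y W x y ^+ 2 = \sum_x \sum_y W x y * W x y.
    by apply: eq_bigr => x _; apply: eq_bigr => y _; rewrite expr2.
  ring.
rewrite !pair_big /=; apply: le_trans (sum_sqr_ge _) _.
rewrite card_prod natrM -expr2 ler_wpM2l ?sqr_ge0 //; apply: ler_sum => -[x y] _ /=.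
rewrite exprMn ler_piMr ?sqr_ge0 // /h; case: (_ && _); rewrite ?expr1n ?expr0n //.
Qed.

(** Energy increment: a violated cut condition splits every class in four and gains more than
    $\delta^2 n^2$, while the energy never exceeds $n^2$. Hence at most $k \ge \delta^{-2}$ rounds;
    classes may be empty. *)
Lemma weak_regularity f (delta : R) (k : nat) :
  (forall x y, 0 <= f x y <= 1) -> 0 < delta -> 1 <= k%:R * delta ^+ 2 ->
  exists (C : finType) (c : V -> C), (#|C| <= 4 ^ k)%N /\
    cut_le (fun x y => f x y - proj f c x y) delta.
Proof.
move=> f01 d0 kd.
have step C (c : V -> C) : cut_le (fun x y => f x y - proj f c x y) delta \/
    exists c' : V -> C * (bool * bool),
      energy f c + delta ^+ 2 * #|V|%:R ^+ 2 < energy f c'.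
  case: (pselect (cut_le (fun x y => f x y - proj f c x y) delta)) => [|ncut]; first by left.
  right; move/existsNP: ncut => [S /existsNP[T /negP]]; rewrite -ltNge => big.
  exists (fun x => (c x, (x \in S, x \in T))).
  have := energy_refine f c S T.
  rewrite /=; set s := \sum_(x in S) _ in big *; set n := #|V|%:R in big *.
  set E' := energy f _; set E := energy f c.
  have n0 : 0 < n.
    rewrite lt_def ler0n andbT; apply: contraTneq big => n0.
    have V0 (x : V) : False.
      by move/eqP: n0; rewrite pnatr_eq0 => /eqP/card0_eq/(_ x).
    by rewrite /s n0 expr0n mulr0 big1 ?normr0 ?ltxx // => x; case: (V0 x).
  move=> h; have : (delta * n ^+ 2) ^+ 2 < s ^+ 2.
    by rewrite -[ltRHS]real_normK ?num_real // ltr_sqr ?nnegrE ?mulr_ge0 ?exprn_ge0 // ltW.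
  move=> /lt_le_trans/(_ h).
  have -> : (delta * n ^+ 2) ^+ 2 = n ^+ 2 * (delta ^+ 2 * n ^+ 2) by ring.
  by rewrite ltr_pM2l ?exprn_gt0 //; lra.
have iter j : (exists (C : finType) (c : V -> C), (#|C| <= 4 ^ j)%N /\
      cut_le (fun x y => f x y - proj f c x y) delta) \/
    exists (C : finType) (c : V -> C), (#|C| <= 4 ^ j)%N /\
      j%:R * delta ^+ 2 * #|V|%:R ^+ 2 <= energy f c.
  elim: j => [|j [[C [c [cC cut]]]|[C [c [cC cE]]]]].
  - right; exists unit, (fun=> tt); rewrite card_unit; split=> //.
    rewrite !mul0r; apply: sumr_ge0 => x _; apply: sumr_ge0 => y _; exact: sqr_ge0.
  - by left; exists C, c; split => //; rewrite (leq_trans cC) // leq_exp2l.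
  - have [cut|[c' cE']] := step C c.
      by left; exists C, c; split => //; rewrite (leq_trans cC) // leq_exp2l.
    right; exists (C * (bool * bool))%type, c'; split.
      by rewrite !card_prod card_bool expnSr leq_mul2r cC orbT.
    by rewrite (le_trans _ (ltW cE')) // -addn1 natrD; lra.
have [//|[C [c [cC cE]]]] := iter k.
exists C, c; split => //; have [//|[c' cE']] := step C c; exfalso.
have := energy_le c' f01; apply/negP; rewrite -ltNge; apply: le_lt_trans cE'.
rewrite (le_trans _ (lerD cE (lexx _))) //.
have : #|V|%:R ^+ 2 * 1 <= #|V|%:R ^+ 2 * (k%:R * delta ^+ 2) :> R.
  by rewrite ler_wpM2l ?sqr_ge0.
have : 0 <= delta ^+ 2 * #|V|%:R ^+ 2 by rewrite mulr_ge0 ?sqr_ge0.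
lra.
Qed.

End WeakRegularity.

(** * The counting lemma for induced densities *)

Section Counting.
Variables (R : realType) (V : finType).
Hypothesis V_gt0 : (0 < #|V|)%N.

Lemma unit_weight_le (A L : V -> R) : (forall x, 0 <= A x <= 1) ->
  \sum_x A x * L x <= \sum_(x in [set x | 0 <= L x]%SET) L x.
Proof.
move=> A01; rewrite [leRHS]big_mkcond; apply: ler_sum => x _; rewrite inE.
have /andP[A0 A1] := A01 x; case: ifPn => [L0|]; first by rewrite ler_piMl.
by rewrite -ltNge => /ltW L0; rewrite mulr_ge0_le0.
Qed.

(** The form is linear in each of the two weights, so its extremes are at indicator functions, where
    the cut norm applies. *)
Lemma cut_le_weight D (delta : R) (A B : V -> R) : cut_le D delta ->
  (forall x, 0 <= A x <= 1) -> (forall x, 0 <= B x <= 1) ->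
  `|avg (fun x => avg (fun y => D x y * (A x * B y)))| <= delta.
Proof.
move=> cutD A01 B01.
have n0 : 0 < #|V|%:R :> R by rewrite ltr0n.
have upper D' : cut_le D' delta -> avg (fun x => avg (fun y => D' x y * (A x * B y))) <= delta.
  move=> cutD'; rewrite /avg -mulr_suml -mulrA -invfM -expr2 ler_pdivrMr ?exprn_gt0 //.
  have -> : \sum_x \sum_y D' x y * (A x * B y) = \sum_x A x * \sum_y B y * D' x y.
    by apply: eq_bigr => x _; rewrite mulr_sumr; apply: eq_bigr => y _; ring.
  apply: le_trans (unit_weight_le _ A01) _; set S := [set x | _]%SET.
  rewrite exchange_big /=; under eq_bigr do rewrite -mulr_sumr.
  apply: le_trans (unit_weight_le _ B01) _; rewrite exchange_big /=.
  exact: le_trans (ler_norm _) (cutD' _ _).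
rewrite ler_norml lerNl upper // andbT.
have cutN : cut_le (fun x y => - D x y) delta.
  move=> S T; apply: le_trans (cutD S T).
  by rewrite -normrN -sumrN; under eq_bigr do rewrite -sumrN; under eq_bigr do under eq_bigr do rewrite opprK.
apply: le_trans (upper _ cutN); rewrite le_eqVlt -mulN1r -avgZ; apply/orP; left; apply/eqP.
by apply: eq_avg => x; rewrite -avgZ; apply: eq_avg => y; ring.
Qed.

Section Replacement.
Variables (I : finType) (delta : R).
Implicit Types (z : {ffun I -> V}).

Lemma prod_itv (T : Type) (s : seq T) (P : pred T) (F : T -> R) : (forall e, 0 <= F e <= 1) ->
  0 <= \prod_(e <- s | P e) F e <= 1.
Proof.
move=> F01; elim/big_rec: _ => [|e y _ /andP[y0 y1]]; first by rewrite ler01 lexx.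
by have /andP[a b] := F01 e; rewrite mulr_ge0 // mulr_ile1.
Qed.

(* Freezing all coordinates but [i] and [j] splits the product into a factor
   depending on [z i] and one depending on [z j]. *)
Lemma avg_pair_factor (i j : I) (D : V -> V -> R) (s : seq (I * I)) (L : I * I -> V -> V -> R) :
  cut_le D delta -> i != j -> (forall e x y, 0 <= L e x y <= 1) ->
  (forall e, e \in s -> ~~ (((e.1 == i) || (e.2 == i)) && ((e.1 == j) || (e.2 == j)))) ->
  `|avg (fun z => D (z i) (z j) * \prod_(e <- s) L e (z e.1) (z e.2))| <= delta.
Proof.
move=> cutD ij L01 sP; have d0 : 0 <= delta.
  have := cutD finset.set0 finset.set0; rewrite big_set0 normr0.
  by rewrite pmulr_lge0 // exprn_gt0 // ltr0n.
rewrite -(avg_upd j _ V_gt0) -(avg_upd i _ V_gt0).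
apply: avg_norm_le => // z.
pose touch (e : I * I) := (e.1 == i) || (e.2 == i).
pose A x := \prod_(e <- s | touch e) L e (upd z i x e.1) (upd z i x e.2).
pose B y := \prod_(e <- s | ~~ touch e) L e (upd z j y e.1) (upd z j y e.2).
have := @cut_le_weight D delta A B cutD.
move=> /(_ (fun x => prod_itv _ _ (fun e => L01 e _ _)) (fun x => prod_itv _ _ (fun e => L01 e _ _))).
congr (`|_| <= _); apply: eq_avg => x; apply: eq_avg => y.
have zi : upd (upd z i x) j y i = x by rewrite !ffunE (negPf ij) eqxx.
have zj : upd (upd z i x) j y j = y by rewrite !ffunE eqxx.
rewrite zi zj; congr (_ * _).
rewrite [RHS](bigID touch) /=; congr (_ * _); rewrite /A /B big_seq_cond [RHS]big_seq_cond;
  apply: eq_bigr => e /andP[/sP es te].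
  have : ~~ ((e.1 == j) || (e.2 == j)) by move: es te; rewrite /touch => + te; rewrite te.
  by rewrite negb_or !ffunE => /andP[/negPf-> /negPf->].
by move: te; rewrite /touch negb_or !ffunE => /andP[/negPf-> /negPf->].
Qed.

End Replacement.

(** Telescoping: [s] lists the pairs that still carry [K], [r] those already switched to [K'], and
    each switch costs [delta]. Listing pairs in increasing order makes two distinct ones share at
    most one vertex, as freezing the other coordinates requires. *)
Lemma avg_replace (h : nat) (delta : R) (s r : seq ('I_h * 'I_h))
    (K K' : 'I_h * 'I_h -> V -> V -> R) :
  (forall e, cut_le (fun x y => K e x y - K' e x y) delta) ->
  (forall e x y, 0 <= K e x y <= 1) -> (forall e x y, 0 <= K' e x y <= 1) ->
  uniq (s ++ r) -> all (fun e : 'I_h * 'I_h => (e.1 < e.2)%N) (s ++ r) ->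
  `|avg (fun z : {ffun 'I_h -> V} => \prod_(e <- s) K e (z e.1) (z e.2) *
                 \prod_(e <- r) K' e (z e.1) (z e.2)) -
    avg (fun z : {ffun 'I_h -> V} => \prod_(e <- s) K' e (z e.1) (z e.2) *
                 \prod_(e <- r) K' e (z e.1) (z e.2))|
  <= (size s)%:R * delta.
Proof.
move=> cut K01 K'01; elim: s r => [|e s IH] r.
  move=> _ _; rewrite mul0r (_ : _ - _ = 0) ?normr0 //.
  by apply/eqP; rewrite subr_eq0; apply/eqP/eq_avg => z; rewrite !big_nil.
move=> usr asr.
have perm : perm_eq ((e :: s) ++ r) (s ++ e :: r) by rewrite -cat1s -catA perm_catCA.
have := IH (e :: r); rewrite -(perm_uniq perm) -(perm_all _ perm) => /(_ usr asr) {}IH.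
pose L e' := if e' \in s then K e' else K' e'.
have L01 e' x y : 0 <= L e' x y <= 1 by rewrite /L; case: ifP.
have e12 : (e.1 < e.2)%N by move: asr => /= /andP[].
have Ls : forall e', e' \in s ++ r -> ~~ (((e'.1 == e.1) || (e'.2 == e.1)) && ((e'.1 == e.2) || (e'.2 == e.2))).
  move=> e' e's; have e'e : e' != e.
    by apply: contraTneq usr => <-; rewrite /= e's.
  have e'12 : (e'.1 < e'.2)%N by move: asr => /= /andP[_ /allP/(_ _ e's)].
  apply: contra e'e; case: e e' e12 e'12 {usr asr perm IH e's} => e1 e2 [e'1 e'2] /= a b.
  rewrite xpair_eqE -!val_eqE /=.
  move=> /andP[/orP[] /eqP c /orP[] /eqP d]; move: a b; rewrite ?c ?d ?eqxx //;
    rewrite -?c -?d ?ltnn // => a b.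
  by have := ltn_trans a b; rewrite ltnn.
have ne12 : e.1 != e.2 by rewrite -val_eqE /= ltn_eqF.
have := avg_pair_factor (cut e) ne12 L01 Ls.
set D := avg _ => hD; set X := avg _; set Y := avg _.
rewrite -(subrKA (avg (fun z : {ffun 'I_h -> V} => \prod_(e <- s) K e (z e.1) (z e.2) *
                 \prod_(e <- e :: r) K' e (z e.1) (z e.2)))).
apply: le_trans (ler_normD _ _) _; rewrite /= -addn1 natrD mulrDl mul1r addrC lerD //.
  apply: le_trans IH; rewrite le_eqVlt; apply/orP; left; apply/eqP; congr `|_ - _|.
  by apply: eq_avg => z; rewrite !big_cons; ring.
apply: le_trans hD; rewrite le_eqVlt; apply/orP; left; apply/eqP; congr `|_|.
rewrite -avgB; apply: eq_avg => z.
have -> : \prod_(e' <- s ++ r) L e' (z e'.1) (z e'.2) =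
    \prod_(e <- s) K e (z e.1) (z e.2) * \prod_(e <- r) K' e (z e.1) (z e.2).
  rewrite big_cat /=; congr (_ * _).
    by apply: eq_big_seq => e' e's; rewrite /L e's.
  apply: eq_big_seq => e' e'r; rewrite /L; case: ifP => // e's.
  move: usr => /= /andP[_]; rewrite cat_uniq => /and3P[_ /hasPn/(_ _ e'r)].
  by rewrite /= e's.
by rewrite !big_cons; ring.
Qed.

Definition indicator_factor (b : bool) (w : R) : R := if b then w else 1 - w.

Definition ind_density (h : nat) (a : rel 'I_h) (W : V -> V -> R) : R :=
  avg (fun z : {ffun 'I_h -> V} =>
    \prod_(e : 'I_h * 'I_h | (e.1 < e.2)%N) indicator_factor (a e.1 e.2) (W (z e.1) (z e.2))).

Lemma indicator_factor_itv b w : 0 <= w <= 1 -> 0 <= indicator_factor b w <= 1.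
Proof. by case: b => //= /andP[w0 w1]; rewrite subr_ge0 w1 gerBl. Qed.

Lemma ind_density_cut (h : nat) (a : rel 'I_h) (W W' : V -> V -> R) (delta : R) :
  0 <= delta -> cut_le (fun x y => W x y - W' x y) delta ->
  (forall x y, 0 <= W x y <= 1) -> (forall x y, 0 <= W' x y <= 1) ->
  `|ind_density a W - ind_density a W'| <= (h * h)%:R * delta.
Proof.
move=> d0 cut W01 W'01.
pose K (F : V -> V -> R) (e : 'I_h * 'I_h) x y := indicator_factor (a e.1 e.2) (F x y).
pose s := enum [pred e : 'I_h * 'I_h | (e.1 < e.2)%N].
have E F : ind_density a F = avg (fun z : {ffun 'I_h -> V} =>
    \prod_(e <- s) K F e (z e.1) (z e.2) * \prod_(e <- [::]) K F e (z e.1) (z e.2)).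
  by apply: eq_avg => z; rewrite big_nil mulr1 big_enum.
rewrite !E.
have -> : avg (fun z : {ffun 'I_h -> V} =>
    \prod_(e <- s) K W e (z e.1) (z e.2) * \prod_(e <- [::]) K W e (z e.1) (z e.2)) =
  avg (fun z : {ffun 'I_h -> V} =>
    \prod_(e <- s) K W e (z e.1) (z e.2) * \prod_(e <- [::]) K W' e (z e.1) (z e.2)).
  by apply: eq_avg => z; rewrite !big_nil.
apply: le_trans (avg_replace (delta := delta) _ _ _ _ _) _; rewrite ?cats0.
- move=> e S T; rewrite /K /indicator_factor; case: (a _ _) => //.
  apply: le_trans (cut S T); rewrite -normrN -sumrN le_eqVlt; apply/orP; left.
  apply/eqP; congr `|_|; apply: eq_bigr => x _; rewrite -sumrN.
  by apply: eq_bigr => y _; ring.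
- by move=> e x y; exact: indicator_factor_itv.
- by move=> e x y; exact: indicator_factor_itv.
- exact: enum_uniq.
- by apply/allP => e; rewrite mem_enum.
- by rewrite ler_wpM2r // ler_nat -cardE (leq_trans (max_card _)) // card_prod card_ord.
Qed.

End Counting.

(** * Supersaturation of patterns *)

(** Induction on the sum of the [r q]: a colour class around a vertex [v] is large by pigeonhole,
    and a homogeneous set of the same colour inside it extends by [v]. *)
Lemma ramsey (C : finType) (r : C -> nat) : exists N : nat,
  forall (T : finType) (S : {set T}) (col : T -> T -> C),
    (forall x y, col x y = col y x) -> (N <= #|S|)%N ->
  exists q (A : {set T}), [/\ A \subset S, (r q <= #|A|)%N &
    {in A &, forall x y, x != y -> col x y = q}].
Proof.
have [n] := ubnP (\sum_q r q)%N; elim: n r => // n IH r; rewrite ltnS => rn.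
have [/existsP[q /eqP rq0]|] := boolP [exists q, r q == 0%N].
  exists 0%N => T S col _ _; exists q, finset.set0; split.
  - exact: finset.sub0set.
  - by rewrite rq0.
  - by move=> x y; rewrite inE.
rewrite negb_exists => /forallP r_gt0.
pose r' q0 q := if q == q0 then (r q).-1 else r q.
have IHq q0 : exists N : nat,
  forall (T : finType) (S : {set T}) (col : T -> T -> C),
    (forall x y, col x y = col y x) -> (N <= #|S|)%N ->
  exists q (A : {set T}), [/\ A \subset S, (r' q0 q <= #|A|)%N &
    {in A &, forall x y, x != y -> col x y = q}].
  apply: IH; apply: leq_trans rn.
  rewrite (bigD1 q0) //= [ltnRHS](bigD1 q0) //= /r' eqxx.
  rewrite (eq_bigr r) => [|q /negPf->//]; rewrite ltn_add2r.
  by rewrite ltn_predL lt0n r_gt0.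
have [N NP] := fin_all_exists IHq.
exists (\sum_q N q).+2 => T S col col_sym SN.
have [v vS] : exists v, v \in S by apply/card_gt0P; apply: leq_trans SN.
pose S_ q := [set x in S | (x != v) && (col v x == q)]%SET.
have [q Nq] : exists q, (N q <= #|S_ q|)%N.
  apply/existsP; apply: contraLR SN; rewrite negb_exists => /forallP few.
  rewrite -ltnNge ltnS (cardsD1 v) vS add1n ltnS.
  have -> : #|(S :\ v)%SET| = (\sum_q #|S_ q|)%N.
    rewrite -sum1_card (partition_big (col v) xpredT) //=; apply: eq_bigr => q _.
    by rewrite sum1_card; apply: eq_card => x; rewrite !inE [in LHS]unfold_in !inE -andbA andbCA.
  by apply: leq_sum => q _; rewrite leqNgt; apply: contra (few q) => /ltnW.
have [q' [A [AS rA homA]]] := NP q T (S_ q) col col_sym Nq.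
have [q'q|q'q] := eqVneq q' q; last first.
  exists q', A; split => //; last by move: rA; rewrite /r' (negPf q'q).
  by apply: fintype.subset_trans AS _; apply/fintype.subsetP => x; rewrite inE => /andP[].
have vA : v \notin A.
  by apply/negP => /(fintype.subsetP AS); rewrite inE eqxx andbF.
exists q, (v |: A)%SET; split.
- apply/fintype.subsetP => x; rewrite !inE => /orP[/eqP->//|/(fintype.subsetP AS)].
  by rewrite inE => /andP[].
- rewrite cardsU1 vA add1n; move: rA; rewrite /r' q'q eqxx.
  by case: (r q).
- have colv x : x \in A -> col v x = q.
    by move=> /(fintype.subsetP AS); rewrite inE => /and3P[_ _ /eqP].
  move=> x y; rewrite !inE => /orP[/eqP->|xA] /orP[/eqP->|yA] xy.
  + by rewrite eqxx in xy.
  + exact: colv.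
  + by rewrite col_sym colv.
  + by rewrite homA ?q'q.
Qed.

Lemma ramsey_injection (C : finType) (h : nat) : exists t : nat,
  forall (col : 'I_t.+1 -> 'I_t.+1 -> C), (forall x y, col x y = col y x) ->
  exists q (rho : 'I_h -> 'I_t.+1), injective rho /\
    forall i j, i != j -> col (rho i) (rho j) = q.
Proof.
have [t tP] := @ramsey C (fun=> h).
exists t => col col_sym; have [|q [A [_ hA homA]]] := tP 'I_t.+1 [set: 'I_t.+1]%SET col col_sym.
  by rewrite cardsT card_ord.
pose rho (i : 'I_h) : 'I_t.+1 := enum_val (widen_ord hA i).
have rho_inj : injective rho by move=> i j /enum_val_inj/(congr1 val) /= ij; apply: val_inj.
exists q, rho; split => // i j ij; apply: homA; rewrite ?enum_valP //.
by rewrite (inj_eq rho_inj).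
Qed.

(** * Supersaturation in blow-ups *)

Section BlowUp.
Variables (R : realType) (V : finType).
Hypothesis V_gt0 : (0 < #|V|)%N.

Lemma avg_comp_inj (H I : finType) (iota : H -> I) (G : {ffun H -> V} -> R) :
  injective iota ->
  avg (fun z : {ffun I -> V} => G [ffun a => z (iota a)]) = avg G.
Proof.
move=> inj; have n0 (J : finType) : (0 < #|{ffun J -> V}|)%N by rewrite card_ffun expn_gt0 V_gt0.
pose rep (z : {ffun I -> V}) (x : {ffun H -> V}) :=
  [ffun i => if [pick a | iota a == i] is Some a then x a else z i].
pose get (z : {ffun I -> V}) := [ffun a => z (iota a)].
have getK z x : get (rep z x) = x.
  apply/ffunP => a; rewrite !ffunE; case: pickP => [b /eqP/inj->//|/(_ a)].
  by rewrite eqxx.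
rewrite -(avg_resample (rep := rep) (get := get)) //.
  rewrite (eq_avg (fun z => eq_avg (fun x => congr1 G (getK z x)))).
  by rewrite avg_cst.
move=> z x; apply/ffunP => i; rewrite !ffunE; case: pickP => [a /eqP<-|].
  by rewrite ffunE.
by [].
Qed.

Variables (k t : nat) (Q : pred {ffun 'I_k -> V}).
Implicit Types (z : {ffun 'I_k * 'I_t.+1 -> V}) (s : seq 'I_k).

Definition select z (sigma : {ffun 'I_k -> 'I_t.+1}) : {ffun 'I_k -> V} :=
  [ffun i => z (i, sigma i)].

(** Every index has t+1 copies, but only the rows in [s] may use a copy other than the first; this
    lets the blow-up be built one row at a time. *)
Definition all_selections s z : bool :=
  [forall sigma : {ffun 'I_k -> 'I_t.+1},
    [forall i, (i \notin s) ==> (sigma i == ord0)] ==> Q (select z sigma)].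

Lemma all_selectionsP s z : reflect (forall sigma : {ffun 'I_k -> 'I_t.+1},
    (forall i, i \notin s -> sigma i = ord0) -> Q (select z sigma)) (all_selections s z).
Proof.
apply: (iffP forallP) => [H sigma s0|H sigma].
  by apply: (implyP (H sigma)); apply/forallP => i; apply/implyP => /s0/eqP.
by apply/implyP => /forallP s0; apply: H => i /(implyP (s0 i))/eqP.
Qed.

(* Redrawing the row of [i], the copies in that row are independent given the
   rest, so Jensen's inequality applies. *)
Lemma blow_up_density s : uniq s ->
  avg (fun x => (Q x)%:R : R) ^+ (t.+1 ^ size s) <= avg (fun z => (all_selections s z)%:R : R).
Proof.
elim: s => [_|i s IH /= /andP[is_ us]].
  rewrite expn0 expr1 -(@avg_comp_inj _ _ (fun i : 'I_k => (i, ord0 : 'I_t.+1))); last first.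
    by move=> i j [].
  rewrite le_eqVlt; apply/orP; left; apply/eqP; apply: eq_avg => z.
  congr (_%:R); congr (nat_of_bool _); apply/idP/all_selectionsP => [Qz sigma s0|].
    have -> // : select z sigma = [ffun i => z (i, ord0)].
    by apply/ffunP => i; rewrite !ffunE s0.
  move=> /(_ [ffun=> ord0]); have -> : select z [ffun=> ord0] = [ffun i => z (i, ord0)].
    by apply/ffunP => i; rewrite !ffunE.
  by apply => i _; rewrite ffunE.
have T0 : (0 < #|{ffun 'I_t.+1 -> V}|)%N by rewrite card_ffun expn_gt0 V_gt0.
have Z0 : (0 < #|{ffun 'I_k * 'I_t.+1 -> V}|)%N by rewrite card_ffun expn_gt0 V_gt0.
pose rep z (u : {ffun 'I_t.+1 -> V}) : {ffun 'I_k * 'I_t.+1 -> V} :=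
  [ffun il => if il.1 == i then u il.2 else z il].
pose get z : {ffun 'I_t.+1 -> V} := [ffun l => z (i, l)].
have repK z u : rep (rep z u) (get z) = z.
  by apply/ffunP => -[j l]; rewrite !ffunE /=; case: eqP => // ->.
have getK z u : get (rep z u) = u by apply/ffunP => l; rewrite !ffunE /= eqxx.
pose g z x : R := (all_selections s (rep z [ffun=> x]))%:R.
have first_copy z u : (all_selections s (rep z u))%:R = g z (u ord0).
  congr (_%:R); congr (nat_of_bool _); apply/all_selectionsP/all_selectionsP => H sigma s0;
  move: (H sigma s0); congr (is_true (Q _)); apply/ffunP => j; rewrite !ffunE /=;
  by case: eqP => // ->; rewrite s0 // ffunE.
(* Once the other rows are fixed, the condition for [i :: s] is the condition for [s] imposed on
   each copy of [i] separately. *)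
have row z u : (all_selections (i :: s) (rep z u))%:R = \prod_l g z (u l).
  have [/all_selectionsP H|nH] := boolP (all_selections (i :: s) (rep z u)).
    rewrite big1 // => l _; rewrite /g; suff -> : all_selections s (rep z [ffun=> u l]) by [].
    apply/all_selectionsP => sigma s0.
    have := H [ffun j => if j == i then l else sigma j].
    have -> : select (rep z u) [ffun j => if j == i then l else sigma j] =
       select (rep z [ffun=> u l]) sigma.
      by apply/ffunP => j; rewrite !ffunE /=; case: eqP => // ->; rewrite ?eqxx ?ffunE.
    apply=> j; rewrite inE negb_or ffunE => /andP[/negPf-> js].
    exact: s0.
  apply/esym/eqP; rewrite prodf_seq_eq0; apply/hasP.
  have [sigma [s0 nQ]] : exists sigma : {ffun 'I_k -> 'I_t.+1},
      (forall j, j \notin i :: s -> sigma j = ord0) /\ ~~ Q (select (rep z u) sigma).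
    move: nH; rewrite negb_forall => /existsP[sigma]; rewrite negb_imply.
    move=> /andP[/forallP s0 nQ]; exists sigma; split => // j.
    by move=> /(implyP (s0 j))/eqP.
  exists (sigma i); first by rewrite mem_index_enum.
  rewrite /= /g pnatr_eq0 eqb0; apply: contra nQ => /all_selectionsP H.
  have := H [ffun j => if j == i then ord0 else sigma j].
  have -> : select (rep z [ffun=> u (sigma i)]) [ffun j => if j == i then ord0 else sigma j] =
     select (rep z u) sigma.
    by apply/ffunP => j; rewrite !ffunE /=; case: eqP => // ->; rewrite ?ffunE.
  apply=> j js; rewrite ffunE; case: eqP => // /eqP ji.
  by apply: s0; rewrite inE negb_or ji.
rewrite -[leRHS](avg_resample (rep := rep) (get := get)) //.
rewrite (eq_avg (fun z => eq_avg (row z))).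
rewrite (eq_avg (fun z => avg_prod 'I_t.+1 (g z))) card_ord.
have -> : (t.+1 ^ (size s).+1 = t.+1 ^ size s * t.+1)%N by rewrite expnSr.
rewrite exprM; apply: le_trans (jensen_avg _ _ _) => //; last first.
  by move=> z; apply: avg_ge0 => x; rewrite ler0n.
have -> : avg (fun z => avg (g z)) = avg (fun z => (all_selections s z)%:R).
  rewrite -[RHS](avg_resample (rep := rep) (get := get)) //.
  apply: eq_avg => z; rewrite (eq_avg (first_copy z)).
  rewrite -[RHS](avg_upd ord0) //.
  rewrite [RHS](eq_avg (G := fun=> avg (g z))) ?avg_cst // => u.
  by apply: eq_avg => x; rewrite ffunE eqxx.
rewrite lerXn2r ?nnegrE ?IH //.
  by rewrite exprn_ge0 // avg_ge0 // => x; rewrite ler0n.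
by rewrite avg_ge0 // => x; rewrite ler0n.
Qed.

End BlowUp.

Section Patterns.
Variables (R : realType) (h : nat) (a : rel 'I_h).

Definition occurs (V : finType) (col : V -> V -> option bool) (x : {ffun 'I_h -> V}) : bool :=
  [forall i, forall j, (i != j) ==> compat (a i j) (col (x i) (x j))].

(** The diagonal holds a dummy [None], since vertex colours are supplied only later, by
    [color_vertices]. *)
Definition pattern (V : finType) (col : V -> V -> option bool) (k : nat)
    (z : {ffun 'I_k -> V}) : {ffun 'I_k * 'I_k -> option bool} :=
  [ffun ij => if ij.1 == ij.2 then None else col (z ij.1) (z ij.2)].

Definition color_vertices (k : nat) (Q : {ffun 'I_k * 'I_k -> option bool})
    (kappa : 'I_k -> bool) (i j : 'I_k) : option bool :=
  if i == j then Some (kappa i) else Q (i, j).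

(* In a large enough blow-up of a pattern each class contains a homogeneous set
   of size [h]; its colour becomes the colour of the vertex, gray counting as
   black because it is compatible with everything. *)
Lemma pattern_density (k : nat) : exists2 t : nat, (0 < t)%N &
  forall (V : finType) (col : V -> V -> option bool) (Q : {ffun 'I_k * 'I_k -> option bool}),
  (0 < #|V|)%N -> (forall x y, col x y = col y x) ->
  (forall kappa, embeds a (color_vertices Q kappa)) ->
  avg (fun z => (pattern col z == Q)%:R : R) ^+ (t ^ k) <=
  #|{ffun 'I_h -> 'I_k * 'I_t}|%:R * avg (fun x => (occurs col x)%:R).
Proof.
have [t tP] := @ramsey_injection (option bool) h.
exists t.+1 => // V col Q V0 col_sym bad.
have := blow_up_density R V0 t (fun z => pattern col z == Q) (enum_uniq 'I_k).
rewrite -cardE card_ord => /le_trans; apply.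
have -> : #|{ffun 'I_h -> 'I_k * 'I_t.+1}|%:R * avg (fun x => (occurs col x)%:R) =
   \sum_(iota : {ffun 'I_h -> 'I_k * 'I_t.+1}) avg (fun x => (occurs col x)%:R) :> R.
  by rewrite sumr_const mulr_natl.
(* A blow-up all of whose selections show [Q] contains an occurrence at some injective placement
   [iota]; sum over all placements. *)
apply: le_trans (_ : \sum_(iota : {ffun 'I_h -> 'I_k * 'I_t.+1} | injectiveb iota)
    avg (fun z : {ffun 'I_k * 'I_t.+1 -> V} => (occurs col [ffun j => z (iota j)])%:R) <= _).
  rewrite -avg_sum; apply: ler_avg => z.
  case: all_selectionsP => [H|_]; last by apply: sumr_ge0 => *; rewrite ler0n.
  have row i := tP (fun l l' => col (z (i, l)) (z (i, l'))) (fun l l' => col_sym _ _).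
  have [q {}row] := fin_all_exists row; have [rho rowP] := fin_all_exists row.
  have [mu muP] := bad (fun i => q i != Some false).
  pose iota := [ffun j => (mu j, rho (mu j) j)].
  have iota_inj : injectiveb iota.
    apply/injectiveP => i j; rewrite !ffunE => -[mij].
    by rewrite mij; case: (rowP (mu j)) => inj _ /inj.
  rewrite (bigD1 iota) //= -[X in X <= _]addr0 lerD //; last first.
    by apply: sumr_ge0 => *; rewrite ler0n.
  suff -> : occurs col [ffun j => z (iota j)] by [].
  apply/forallP => i; apply/forallP => j; apply/implyP => ij; rewrite !ffunE.
  have := muP i j ij; rewrite /color_vertices; case: eqP => [mij|/eqP mij].
    rewrite -mij (rowP (mu i)).2 //; case: (q (mu i)) => [[]|] //=.
  suff -> : Q (mu i, mu j) = col (z (mu i, rho (mu i) i)) (z (mu j, rho (mu j) j)) by [].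
  (* The two copies belong to different rows, so a single selection contains both. *)
  have := H [ffun m => if m == mu i then rho (mu i) i else rho (mu j) j].
  move=> /(_ _)/eqP <-; last by move=> m; rewrite mem_enum.
  by rewrite !ffunE /= (negPf mij) eqxx eq_sym (negPf mij).
rewrite big_mkcond; apply: ler_sum => iota _; case: ifP => [/injectiveP inj|_].
  by rewrite (avg_comp_inj V0 (fun x => (occurs col x)%:R) inj).
by apply: avg_ge0 => x; rewrite ler0n.
Qed.

Lemma avg_pair (V : finType) (k : nat) (i j : 'I_k) (F : V -> V -> R) :
  (0 < #|V|)%N -> i != j ->
  avg (fun z : {ffun 'I_k -> V} => F (z i) (z j)) = avg (fun x => avg (F x)).
Proof.
move=> V0 ij; rewrite -(avg_upd j _ V0) -(avg_upd i _ V0).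
have -> // : avg (fun z : {ffun 'I_k -> V} => avg (fun x => avg (fun y =>
   F (upd (upd z i x) j y i) (upd (upd z i x) j y j)))) =
   avg (fun z : {ffun 'I_k -> V} => avg (fun x => avg (F x))).
  apply: eq_avg => z; apply: eq_avg => x; apply: eq_avg => y.
  by rewrite !ffunE (negPf ij) !eqxx.
by rewrite avg_cst // card_ffun expn_gt0 V0.
Qed.

(** A pattern of probability at least [tau] has a vertex colouring without an embedding, as
    otherwise [pattern_density] would produce too many occurrences. The quadratic form at uniform
    weights then bounds its cost. The rarer patterns have total probability at most eps/2, and
    dropping the diagonal loses at most $1/n \le$ eps/2. *)
Lemma avg_cost_ge (p eps : R) : richly_contractible a -> 0 < p -> 7 * p < 1 -> 0 < eps ->
  exists2 theta : R, 0 < theta &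
  forall (V : finType) (col : V -> V -> option bool),
    (0 < #|V|)%N -> (forall x y, col x y = col y x) ->
    avg (fun x => (occurs col x)%:R) < theta ->
    p * (1 - p) / (1 + 2 * p) - eps <= avg (fun x => avg (fun y => cost p (col x y))).
Proof.
move=> ra p_gt0 p_lt eps_gt0; set g := p * (1 - p) / (1 + 2 * p).
have g_le1 : g <= 1 by rewrite ler_pdivrMr; nra.
have [k k_gt] : exists k : nat, 2 / eps < k.+1%:R.
  exists (Num.truncn (2 / eps)); have := truncnS_gt (2 / eps); by [].
have k0 : 0 < k.+1%:R :> R by rewrite ltr0n.
set n := k.+1%:R in k_gt k0.
have kV : n^-1 <= eps / 2.
  by rewrite -[leRHS]invrK lef_pV2 ?posrE ?invr_gt0 ?divr_gt0 // invf_div ltW.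
have [t t0 tP] := pattern_density k.+1.
pose N : R := #|{ffun 'I_k.+1 * 'I_k.+1 -> option bool}|%:R.
have N0 : 0 < N by rewrite ltr0n card_ffun expn_gt0 card_option card_bool.
pose tau := eps / 2 / N.
have tau0 : 0 < tau by rewrite !divr_gt0.
pose m : R := #|{ffun 'I_h -> 'I_k.+1 * 'I_t}|%:R.
have m0 : 0 < m.
  by rewrite ltr0n card_ffun expn_gt0 card_prod !card_ord muln_gt0 t0.
exists (tau ^+ (t ^ k.+1) / m) => [|V col V0 col_sym few].
  by rewrite divr_gt0 // exprn_gt0.
pose P Q := avg (fun z : {ffun 'I_k.+1 -> V} => (pattern col z == Q)%:R : R).
have P_ge0 Q : 0 <= P Q by apply: avg_ge0 => z; rewrite ler0n.
have costP c : 0 <= cost p c <= 1 by case: c => [[]|] /=; lra.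
have n2_ge0 : 0 <= n^-1 ^+ 2 by rewrite exprn_ge0 // invr_ge0 ltW.
pose C (z : {ffun 'I_k.+1 -> V}) : R := n^-1 ^+ 2 * \sum_(i < k.+1) \sum_(j < k.+1 | i != j) cost p (col (z i) (z j)).
have C_ge (z : {ffun 'I_k.+1 -> V}) :
    g - n^-1 - \sum_(Q | P Q < tau) (pattern col z == Q)%:R <= C z.
  set Q := pattern col z; have C0 : 0 <= C z.
    apply: mulr_ge0 => //.
    by apply: sumr_ge0 => i _; apply: sumr_ge0 => j _; case/andP: (costP (col (z i) (z j))).
  have [PQ|PQ] := ltP (P Q) tau.
    rewrite (bigD1 Q) //= eqxx; have : 0 <= \sum_(i | (P i < tau) && (i != Q)) (Q == i)%:R :> R.
      by apply: sumr_ge0 => *; rewrite ler0n.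
    have : 0 < n^-1 by rewrite invr_gt0.
    rewrite (_ : true%:R = 1) //; move: (\sum_(i | _) _) (n^-1) (C z) C0 g_le1 => S u c; clear; lra.
  rewrite big1 ?subr0 => [|Q' PQ']; last first.
    by case: eqP => // QQ'; move: PQ'; rewrite -QQ' ltNge PQ.
  have /existsNP[kappa nemb] : ~ (forall kappa, embeds a (color_vertices Q kappa)).
    move=> /(tP V col Q V0 col_sym); apply/negP; rewrite -ltNge.
    apply: lt_le_trans (_ : tau ^+ (t ^ k.+1) <= _).
      by rewrite -/m mulrC -ltr_pdivlMr.
    by apply: lerXn2r; rewrite ?nnegrE; [exact: ltW | exact: P_ge0 | exact: PQ].
  have := @embedding_free_bound R k.+1 h a (color_vertices Q kappa) p (fun=> n^-1) ra.
  move=> /(_ _ _ p_gt0 p_lt _ _ nemb) H.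
  rewrite lerBlDr; apply: le_trans (H _ _ _ _) _.
  - move=> i j; rewrite /color_vertices eq_sym; case: eqP => [->//|/eqP ij].
    by rewrite /Q !ffunE /= eq_sym (negPf ij) col_sym.
  - by move=> i; rewrite /color_vertices eqxx.
  - by move=> i; rewrite invr_ge0 ltW.
  - by rewrite sumr_const card_ord -mulr_natl divff // gt_eqF.
  have nE : n^-1 = n^-1 ^+ 2 * \sum_(i < k.+1) 1.
    by rewrite sumr_const card_ord expr2 -mulrA mulVf ?mulr1 ?gt_eqF.
  rewrite [X in _ <= _ + X]nE /C -mulrDr -big_split /= /qform mulr_sumr; apply: ler_sum => i _.
  have -> : \sum_j n^-1 * n^-1 * cost p (color_vertices Q kappa i j) =
     n^-1 ^+ 2 * \sum_j cost p (color_vertices Q kappa i j).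
    by rewrite mulr_sumr; apply: eq_bigr => j _; rewrite expr2.
  apply: ler_wpM2l => //; rewrite (bigD1 i) //= addrC lerD //.
    rewrite le_eqVlt; apply/orP; left; apply/eqP; apply: eq_big => j; first by rewrite eq_sym.
    by move=> ji; rewrite /color_vertices /Q eq_sym (negPf ji) ffunE /= eq_sym (negPf ji).
  by case/andP: (costP (color_vertices Q kappa i i)).
have := ler_avg C_ge.
have Z0 : (0 < #|{ffun 'I_k.+1 -> V}|)%N by rewrite card_ffun expn_gt0 V0.
rewrite avgB avg_cst // avg_sum => h1.
have h2 : \sum_(Q | P Q < tau) P Q <= eps / 2.
  apply: le_trans (_ : \sum_(Q : {ffun 'I_k.+1 * 'I_k.+1 -> option bool}) tau <= _).
    rewrite big_mkcond; apply: ler_sum => Q _; case: ifP => [/ltW//|_]; exact: ltW.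
  by rewrite sumr_const -(mulr_natr tau) -/N /tau divfK // gt_eqF.
have h3 : avg C <= avg (fun x => avg (fun y => cost p (col x y))).
  rewrite /C avgZ avg_sum; set c := avg (fun x => avg _).
  have c0 : 0 <= c.
    by apply: avg_ge0 => x; apply: avg_ge0 => y; case/andP: (costP (col x y)).
  have -> : \sum_(i < k.+1) avg (fun z : {ffun 'I_k.+1 -> V} =>
      \sum_(j < k.+1 | i != j) cost p (col (z i) (z j))) =
    \sum_(i < k.+1) \sum_(j < k.+1 | i != j) c.
    apply: eq_bigr => i _; rewrite avg_sum; apply: eq_bigr => j ij.
    exact: (avg_pair (fun x y => cost p (col x y)) V0 ij).
  have : \sum_(i < k.+1) \sum_(j < k.+1 | i != j) c <= \sum_(i < k.+1) \sum_(j < k.+1) c.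
    apply: ler_sum => i _; rewrite [leLHS]big_mkcond; apply: ler_sum => j _.
    by case: ifP.
  rewrite !sumr_const card_ord -mulrnA -(mulr_natl c) natrM -/n => h4.
  apply: le_trans (ler_wpM2l n2_ge0 h4) _.
  have -> : n^-1 ^+ 2 * (n * n * c) = (n^-1 * n) ^+ 2 * c by ring.
  by rewrite mulVf ?gt_eqF // expr1n mul1r.
have h1' : g - n^-1 - \sum_(Q | P Q < tau) P Q <= avg C by [].
apply: le_trans h3; apply: le_trans h1'.
by move: (n^-1) kV (\sum_(Q | _) P Q) h2 => u hu S hS; lra.
Qed.

End Patterns.

(** * The lower bound for quasirandom graphs *)

Lemma adj_sym (T : finType) (G : graph T) : symmetric (adj G).
Proof. by move=> x y; rewrite /adj finset.setUC. Qed.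

Lemma adj_irr (T : finType) (G : graph T) : irreflexive (adj G).
Proof.
move=> x; apply/negbTE/negP => xx.
have /forall_inP/(_ _ xx) := edges_card2 G.
by rewrite finset.setUid cards1.
Qed.

(** Densities also average over non-injective tuples. Without twins, a map respecting adjacency on
    distinct pairs is injective, so an induced-free graph has density exactly 0. *)
Definition twin_free (h : nat) (a : rel 'I_h) := forall i j, i != j -> exists l, a i l != a j l.

Section CutLowerBound.
Variables (R : realType) (V : finType).
Hypothesis V_gt0 : (0 < #|V|)%N.

Lemma ind_density_free (h : nat) (H : graph 'I_h) (G : graph V) :
  twin_free (adj H) -> ~~ induced_subgraph H G ->
  ind_density (adj H) (fun x y => (adj G x y)%:R : R) = 0.
Proof.
move=> tw free; rewrite /ind_density (eq_avg (G := fun=> 0)).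
  by rewrite /avg big1 ?mul0r.
move=> z; apply/eqP; apply: contraNT free => prod_neq0.
have zE i j : i != j -> adj G (z i) (z j) = adj H i j.
  wlog ij : i j / (i < j)%N.
    move=> W ij; case: (ltngtP i j) => [/W/(_ ij)//|ji|/val_inj eij].
      by rewrite adj_sym W // 1?adj_sym // eq_sym.
    by rewrite eij eqxx in ij.
  move=> _; move: prod_neq0; rewrite (bigD1 (i, j)) //= mulf_eq0 negb_or => /andP[+ _].
  rewrite /indicator_factor; case: (adj H i j); case: (adj G _ _) => //=.
    by rewrite eqxx.
  by rewrite subrr eqxx.
apply/existsP; exists z; apply/andP; split.
  apply/injectiveP => i j zij; apply/eqP; apply/negP => /negP ij.
  have [l] := tw i j ij; apply/negP; rewrite negbK; apply/eqP.
  have [->|li] := eqVneq l i.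
    rewrite adj_irr -zE 1?eq_sym // zij adj_irr //.
  have [->|lj] := eqVneq l j; first by rewrite adj_irr -zE // zij adj_irr.
  by rewrite -!zE 1?eq_sym // zij.
apply/forallP => i; apply/forallP => j; apply/eqP.
have [->|ij] := eqVneq i j; first by rewrite !adj_irr.
exact: zE.
Qed.

(* Testing f - g against the sign of f_P - p, which is constant on blocks. *)
Lemma avg_dist_ge (C : finType) (c : V -> C) (f g : V -> V -> R) (p gamma : R) :
  cut_le (fun x y => g x y - p) gamma ->
  avg (fun x => avg (fun y => `|proj f c x y - p|)) - #|C|%:R ^+ 2 * gamma <=
  avg (fun x => avg (fun y => `|g x y - f x y|)).
Proof.
move=> cut; have n0 : 0 < #|V|%:R :> R by rewrite ltr0n.
have n2 : 0 < #|V|%:R ^+ 2 :> R by rewrite exprn_gt0.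
rewrite /avg -!mulr_suml -!mulrA -!invfM -!expr2 -(ler_pM2r n2) mulrBl.
rewrite !mulfVK ?gt_eqF //.
pose s a b : R := if p <= block_mean f c a b then 1 else -1.
have s1 a b : `|s a b| = 1 by rewrite /s; case: ifP; rewrite ?normrN normr1.
have E1 : \sum_x \sum_y `|proj f c x y - p| =
    \sum_x \sum_y f x y * s (c x) (c y) - \sum_x \sum_y p * s (c x) (c y).
  rewrite -(sum_proj f c s) -sumrB; apply: eq_bigr => x _; rewrite -sumrB.
  apply: eq_bigr => y _; rewrite -mulrBl /s /proj.
  case: leP => h; first by rewrite ger0_norm ?subr_ge0 ?mulr1.
  by rewrite ltr0_norm ?subr_lt0 // mulrN1.
have E2 : `|\sum_x \sum_y (g x y - p) * s (c x) (c y)| <=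
    #|C|%:R ^+ 2 * gamma * #|V|%:R ^+ 2.
  rewrite (sum_blocks c); apply: le_trans (ler_norm_sum _ _ _) _.
  have -> : #|C|%:R ^+ 2 * gamma * #|V|%:R ^+ 2 = \sum_(a : C) \sum_(b : C) gamma * #|V|%:R ^+ 2.
    by rewrite !sumr_const -mulrnA -(mulr_natl (_ * _)) natrM expr2 !mulrA.
  apply: ler_sum => a _; apply: le_trans (ler_norm_sum _ _ _) _; apply: ler_sum => b _.
  have -> : \sum_(x | c x == a) \sum_(y | c y == b) (g x y - p) * s (c x) (c y) =
      s a b * \sum_(x in [set x | c x == a]%SET) \sum_(y in [set y | c y == b]%SET) (g x y - p).
    rewrite mulr_sumr; apply: eq_big => [x|x /eqP->]; first by rewrite inE.
    rewrite mulr_sumr; apply: eq_big => [y|y /eqP->]; first by rewrite inE.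
    by rewrite mulrC.
  by rewrite normrM s1 mul1r.
have E3 : \sum_x \sum_y f x y * s (c x) (c y) - \sum_x \sum_y g x y * s (c x) (c y) <=
   \sum_x \sum_y `|g x y - f x y|.
  rewrite -sumrB; apply: ler_sum => x _; rewrite -sumrB; apply: ler_sum => y _.
  rewrite -mulrBl (le_trans (ler_norm _)) // normrM s1 mulr1 distrC //.
have E4 : \sum_x \sum_y (g x y - p) * s (c x) (c y) =
   \sum_x \sum_y g x y * s (c x) (c y) - \sum_x \sum_y p * s (c x) (c y).
  rewrite -sumrB; apply: eq_bigr => x _; rewrite -sumrB.
  by apply: eq_bigr => y _; rewrite mulrBl.
rewrite E1; move: E2; rewrite E4 ler_norml => /andP[_ E2]; lra.
Qed.

End CutLowerBound.

Section DistanceLowerBound.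
Variables (R : realType) (h : nat).
Hypotheses (rich : richly_contractible (adj (C_ h))) (tw : twin_free (adj (C_ h))).

Definition threshold (T : Type) (eps : R) (W : T -> T -> R) (x y : T) : option bool :=
  if W x y <= eps then Some false else if 1 - eps <= W x y then Some true else None.

Lemma distance_lower_bound (p eps : R) : 0 < p -> 7 * p < 1 -> 0 < eps ->
  exists2 gamma : R, 0 < gamma & forall (V : finType) (G G' : graph V),
    (0 < #|V|)%N -> cut_le (fun x y => (adj G x y)%:R - p) gamma ->
    ~~ induced_subgraph (C_ h) G' ->
  p * (1 - p) / (1 + 2 * p) - eps <=
  avg (fun x => avg (fun y => `|(adj G x y)%:R - (adj G' x y)%:R|)).
Proof.
move=> p0 p1 eps0.
(* A third of [eps] each for the average cost, for the thresholds, and for passing from the graphs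
   to the projected kernel. With $e \le 1/2$ a pair with $W \le e$ gives a non-edge factor at least
   [e]. *)
pose e := Num.min (eps / 3) (1 / 2).
have e0 : 0 < e by rewrite lt_min !divr_gt0.
have e1 : e <= 1 / 2 by rewrite ge_min lexx orbT.
have e_eps : 3 * e <= eps.
  have : e <= eps / 3 by rewrite ge_min lexx.
  lra.
have [theta theta0 dense] := avg_cost_ge rich p0 p1 e0.
have m0 : 0 < (h * h).+1%:R :> R by rewrite ltr0n.
set m := (h * h).+1%:R in m0.
(* Each compatible tuple contributes at least $e^{h^2}$ to the density, while regularity bounds the
   density by $h^2\delta < \theta e^{h^2}$. *)
pose delta := theta * e ^+ (h * h) / m.
have delta0 : 0 < delta by rewrite divr_gt0 // mulr_gt0 // exprn_gt0.
have [k kd] : exists k : nat, 1 <= k%:R * delta ^+ 2.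
  exists (Num.truncn (delta ^+ 2)^-1).+1.
  rewrite -ler_pdivrMr ?exprn_gt0 // mul1r; exact/ltW/truncnS_gt.
pose M : R := (4 ^ k)%:R.
have M0 : 0 < M by rewrite ltr0n expn_gt0.
exists (e / M ^+ 2) => [|V G G' V0 cut free]; first by rewrite divr_gt0 // exprn_gt0.
pose f x y : R := (adj G' x y)%:R.
have f01 x y : 0 <= f x y <= 1 by rewrite /f; case: (adj _ _ _); rewrite ?lexx ?ler01.
have [C [c [cC creg]]] := weak_regularity f01 delta0 kd.
set W := proj f c in creg.
have W01 := proj_itv c f01.
pose col := threshold e W.
have Wsym x y : W x y = W y x.
  rewrite /W /proj /block_mean; congr (_ / _); last by rewrite mulrC.
  by rewrite exchange_big; apply: eq_bigr => y' _; apply: eq_bigr => x' _; rewrite /f adj_sym.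
have col_sym x y : col x y = col y x by rewrite /col /threshold Wsym.
have few : avg (fun x => (occurs (adj (C_ h)) col x)%:R) < theta.
  have dW : ind_density (adj (C_ h)) W <= (h * h)%:R * delta.
    have := ind_density_cut V0 (adj (C_ h)) (ltW delta0) creg f01 W01.
    by rewrite (ind_density_free R tw free) sub0r normrN; apply: le_trans (ler_norm _).
  have lower : e ^+ (h * h) * avg (fun x => (occurs (adj (C_ h)) col x)%:R) <=
      ind_density (adj (C_ h)) W.
    rewrite -avgZ; apply: ler_avg => z; case: (boolP (occurs _ _ z)) => [occ|_]; last first.
      by rewrite mulr0; apply: prodr_ge0 => i _; case/andP: (indicator_factor_itv (adj (C_ h) i.1 i.2) (W01 (z i.1) (z i.2))).
    rewrite mulr1; apply: le_trans (_ : \prod_(i : 'I_h * 'I_h | (i.1 < i.2)%N) e <= _).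
      rewrite prodr_const; apply: ler_wiXn2l; [exact: ltW | lra |].
      by rewrite (leq_trans (max_card _)) // card_prod card_ord.
    apply: ler_prod => -[i j] /= ij; rewrite ltW //=.
    have := forallP occ i => /forallP/(_ j); rewrite -val_eqE neq_ltn ij /=.
    rewrite /compat /col /threshold /indicator_factor; case: (adj _ i j) => /=.
      by case: (leP (W (z i) (z j)) e) => // /ltW.
    case: (leP (W (z i) (z j)) e) => [Wle _|_]; first lra.
    by case: (leP (1 - e) (W (z i) (z j))) => // ? _; lra.
  rewrite -(ltr_pM2l (exprn_gt0 (h * h) e0)); apply: le_lt_trans (le_trans lower dW) _.
  have -> : (h * h)%:R * delta = e ^+ (h * h) * theta * ((h * h)%:R / m).
    by rewrite /delta; ring.
  rewrite gtr_pMr ?mulr_gt0 ?exprn_gt0 // ltr_pdivrMr // mul1r.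
  by rewrite ltr_nat.
have costW x y : cost p (col x y) - e <= `|W x y - p|.
  rewrite /col /threshold; case: (leP (W x y) e) => [Wle|_] /=.
    by rewrite distrC; have := ler_norm (p - W x y); lra.
  case: (leP (1 - e) (W x y)) => [Wge|_] /=.
    by have := ler_norm (W x y - p); lra.
  by have := normr_ge0 (W x y - p); lra.
have h1 := dense V col V0 col_sym few.
have h2 : avg (fun x => avg (fun y => cost p (col x y))) - e <= avg (fun x => avg (fun y => `|W x y - p|)).
  rewrite -[X in _ - X](avg_cst e V0) -avgB; apply: ler_avg => x.
  by rewrite -[X in _ - X](avg_cst e V0) -avgB; apply: ler_avg.
have h3 := avg_dist_ge V0 c f cut.
have h4 : #|C|%:R ^+ 2 * (e / M ^+ 2) <= e.
  rewrite mulrCA ler_piMr ?(ltW e0) // ler_pdivrMr ?exprn_gt0 // mul1r.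
  by rewrite lerXn2r ?nnegrE ?ler0n // ler_nat.
apply: le_trans h3; move: h2; rewrite -/W; lra.
Qed.

End DistanceLowerBound.

(** * Edge counts as sums over ordered pairs *)

Section GraphCounting.
Variables (R : realType) (T : finType).

Lemma sum_ordered_pairs (E : {set {set T}}) : [forall e in E, #|e| == 2%N] ->
  \sum_x \sum_y ([set x; y]%SET \in E)%:R = 2 * #|E|%:R :> R.
Proof.
move=> /forall_inP E2; rewrite pair_big /=.
have -> : \sum_(p : T * T) ([set p.1; p.2]%SET \in E)%:R =
    \sum_(p : T * T | [set p.1; p.2]%SET \in E) 1 :> R.
  by rewrite [RHS]big_mkcond; apply: eq_bigr => p _; case: (_ \in _).
rewrite (partition_big (fun p : T * T => [set p.1; p.2]%SET) (mem E)) //=.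
rewrite (eq_bigr (fun=> 2)) ?sumr_const ?mulr_natr // => e eE.
have /cards2P[a [b [ab eab]]] := E2 e eE.
rewrite sumr_const; congr (_%:R).
have -> : 2%N = #|[set (a, b); (b, a)]%SET|.
  by rewrite cards2 xpair_eqE negb_and ab.
apply: eq_card => -[x y]; rewrite !inE unfold_in /= !xpair_eqE.
apply/andP/orP => [[_ /eqP exy]|].
  rewrite eab in exy; have [[-> ->]|[-> ->]] := pair_set_eq ab exy; rewrite !eqxx; auto.
case=> /andP[/eqP-> /eqP->]; first by rewrite -eab eE eqxx.
by rewrite finset.setUC -eab eE eqxx.
Qed.

Lemma sum_adj (G : graph T) : \sum_x \sum_y (adj G x y)%:R = 2 * #|edges G|%:R :> R.
Proof. exact: sum_ordered_pairs (edges_card2 G). Qed.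

Lemma sum_adj_diff (G G' : graph T) :
  \sum_x \sum_y `|(adj G x y)%:R - (adj G' x y)%:R| =
  2 * #|((edges G :\: edges G') :|: (edges G' :\: edges G))%SET|%:R :> R.
Proof.
rewrite -sum_ordered_pairs.
  apply: eq_bigr => x _; apply: eq_bigr => y _; rewrite !inE /adj.
  by case: (_ \in edges G); case: (_ \in edges G') => /=; rewrite ?subrr ?normr0 // ?subr0 ?normr1 // sub0r normrN normr1.
apply/forall_inP => e; rewrite !inE => /orP[] /andP[_].
  by move/forall_inP: (edges_card2 G); apply.
by move/forall_inP: (edges_card2 G'); apply.
Qed.

Lemma graph_of_rel (e : rel T) : symmetric e -> irreflexive e ->
  exists G : graph T, adj G =2 e.
Proof.
move=> e_sym e_irr.
pose E := [set A : {set T} | [exists x, [exists y, (A == [set x; y]%SET) && e x y]]]%SET.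
have E2 : [forall A in E, #|A| == 2%N].
  apply/forall_inP => A; rewrite inE => /existsP[x /existsP[y /andP[/eqP-> xy]]].
  by rewrite cards2 (contraTneq _ xy) // => ->; rewrite e_irr.
exists (Graph E2) => x y; rewrite /adj /= inE.
apply/existsP/idP => [[a /existsP[b /andP[/eqP exy ab]]]|exy]; last first.
  by exists x; apply/existsP; exists y; rewrite eqxx.
have neq : a != b by apply: contraTneq ab => ->; rewrite e_irr.
by have [[-> ->]|[-> ->]] := pair_set_eq neq exy; rewrite // e_sym.
Qed.

(** The new graph is a subgraph or a supergraph of [G], so the symmetric difference is just the
    change in the number of edges. *)
Lemma adjust_edge_number (G : graph T) (m : nat) : (m <= 'C(#|T|, 2))%N ->
  exists G' : graph T, #|edges G'| = m /\
  \sum_x \sum_y `|(adj G' x y)%:R - (adj G x y)%:R| = 2 * `|m%:R - #|edges G|%:R| :> R.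
Proof.
move=> mC; pose D := [set A : {set T} | #|A| == 2%N]%SET.
have GD : edges G \subset D.
  by apply/fintype.subsetP => e eG; rewrite inE; move/forall_inP: (edges_card2 G); apply.
have sub_graph (E : {set {set T}}) : E \subset D -> [forall e in E, #|e| == 2%N].
  by move=> /fintype.subsetP ED; apply/forall_inP => e /ED; rewrite inE.
have card_sub (A : {set {set T}}) j : (j <= #|A|)%N -> exists2 B : {set {set T}}, B \subset A & #|B| = j.
  move=> jA; exists [set x in take j (enum A)]%SET.
    by apply/fintype.subsetP => x; rewrite inE => /mem_take; rewrite mem_enum.
  by rewrite cardsE; move/card_uniqP: (take_uniq j (enum_uniq A)) => ->; rewrite size_takel // -cardE.
have [mG|/ltnW mG] := leqP m #|edges G|.
  have [B BG Bm] := card_sub _ _ mG.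
  exists (Graph (sub_graph B (fintype.subset_trans BG GD))); split=> //.
  rewrite sum_adj_diff /=; congr (2 * _).
  have -> : (B :\: edges G = finset.set0)%SET by apply/eqP; rewrite finset.setD_eq0.
  rewrite finset.set0U cardsD (finset.setIidPr BG) Bm natrB // distrC ger0_norm //.
  by rewrite subr_ge0 ler_nat.
have [|B BG Bm] := card_sub (D :\: edges G)%SET (m - #|edges G|)%N.
  by rewrite cardsD (finset.setIidPr GD) leq_sub2r // card_draws.
have BD : B \subset D by apply: fintype.subset_trans BG _; exact: finset.subsetDl.
have GBD : (edges G :|: B)%SET \subset D by rewrite finset.subUset GD.
have dis : (edges G :&: B = finset.set0)%SET.
  apply/finset.setP => e; rewrite !inE; apply/negP => /andP[eG /(fintype.subsetP BG)].
  by rewrite !inE eG.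
exists (Graph (sub_graph _ GBD)); split=> /=.
  by rewrite cardsU dis cards0 subn0 Bm subnKC.
rewrite sum_adj_diff /=; congr (2 * _).
have -> : (edges G :\: (edges G :|: B) = finset.set0)%SET.
  by apply/eqP; rewrite finset.setD_eq0 finset.subsetUl.
rewrite finset.setU0 finset.setDUl finset.setDv finset.set0U.
rewrite cardsD finset.setIC dis cards0 subn0 Bm natrB // ger0_norm //.
by rewrite subr_ge0 ler_nat.
Qed.

(** Only an inequality: the average also runs over the diagonal, so it divides by $n^2$ instead of
    $n(n-1)$. *)
Lemma dist_avg (G G' : graph T) : (1 < #|T|)%N ->
  avg (fun x => avg (fun y => `|(adj G x y)%:R - (adj G' x y)%:R|)) <= dist R G G'.
Proof.
move=> T1; rewrite /avg -mulr_suml -mulrA -invfM sum_adj_diff /dist.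
set d := #|_|%:R; set n := #|T|%:R.
have n0 : 0 < n by rewrite ltr0n ltnW.
have C0 : 0 < 'C(#|T|, 2)%:R :> R by rewrite ltr0n bin_gt0.
rewrite ler_pdivrMr ?mulr_gt0 // mulrAC ler_pdivlMr //.
have -> : 2 * d * 'C(#|T|, 2)%:R = d * ('C(#|T|, 2).*2)%:R.
  by rewrite -muln2 natrM; ring.
rewrite ler_wpM2l ?ler0n // -natrM ler_nat bin2 halfK.
by rewrite (leq_trans (leq_subr _ _)) // leq_mul2l leq_pred orbT.
Qed.

End GraphCounting.

(** * A pseudorandom kernel from the affine plane over a finite field *)

Section LineIncidence.
Variables (R : realType) (F : finFieldType) (A : {set F}).
Let U : finType := (F * F)%type.
Let q : R := #|F|%:R.

(** For fixed [u] and fixed value, the points [v] form a line of slope [- u.1]; this form of the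
    incidence relation is symmetric and so yields an undirected graph. *)
Definition incidence (u v : F * F) : F := u.1 * v.1 + u.2 + v.2.

Lemma incidence_sym u v : incidence u v = incidence v u.
Proof. by rewrite /incidence mulrC addrAC. Qed.

Definition deviation (u v : F * F) : R := (incidence u v \in A)%:R - #|A|%:R / q.

Let q_gt0 : 0 < q.
Proof. by rewrite ltr0n; apply/card_gt0P; exists 0. Qed.

Lemma deviation_itv u v : `|deviation u v| <= 1.
Proof.
have A0 : 0 <= #|A|%:R / q <= 1.
  by rewrite divr_ge0 ?ler0n //= ler_pdivrMr // mul1r ler_nat max_card.
by rewrite /deviation ler_norml; case: (_ \in A) => /=; lra.
Qed.

(* For distinct slopes the two incidence values are jointly uniform. *)
Lemma deviation_orthogonal (u u' : U) : u.1 != u'.1 ->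
  \sum_(v : U) deviation u v * deviation u' v = 0.
Proof.
move=> uu'; pose D (s : F) : R := (s \in A)%:R - #|A|%:R / q.
pose phi (v : U) : U := (incidence u v, incidence u' v).
have phi_inj : injective phi.
  move=> [v1 v2] [w1 w2]; rewrite /phi /incidence /= => -[e1 e2].
  have : (u.1 - u'.1) * (v1 - w1) = 0.
    have -> : (u.1 - u'.1) * (v1 - w1) = (u.1 * v1 + u.2 + v2 - (u.1 * w1 + u.2 + w2)) -
       (u'.1 * v1 + u'.2 + v2 - (u'.1 * w1 + u'.2 + w2)) by ring.
    by rewrite e1 e2 !subrr.
  move/eqP; rewrite mulf_eq0 subr_eq0 (negPf uu') /= subr_eq0 => /eqP v1w1.
  by move: e1; rewrite v1w1 => /addrI ->.
have sumD : \sum_s D s = 0.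
  rewrite sumrB sumr_const; have -> : \sum_(s : F) (s \in A)%:R = #|A|%:R :> R.
    by rewrite -sumr_const [RHS]big_mkcond; apply: eq_bigr => s _; case: (_ \in A).
  by rewrite -(mulr_natr (_ / _)) divfK ?subrr // gt_eqF.
have -> : \sum_(v : U) deviation u v * deviation u' v = \sum_(v : U) D (phi v).1 * D (phi v).2 by [].
have -> : \sum_(v : U) D (phi v).1 * D (phi v).2 = \sum_(v : U) D v.1 * D v.2.
  by rewrite [RHS](reindex_inj phi_inj).
rewrite -(pair_bigA _ (fun s t => D s * D t)) /=.
by under eq_bigr do rewrite -mulr_sumr sumD mulr0; rewrite big1.
Qed.

(** Cauchy-Schwarz in [v] leaves inner products of rows, which vanish for distinct slopes: only
    $q^3$ of the $q^4$ pairs of rows survive. This gains a factor $q$ over the trivial bound $c^4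
    q^8$. The weights up to [c] are the fibre sizes of a blow-up. *)
Lemma deviation_cut (s t : U -> R) (c : R) :
  (forall u, 0 <= s u <= c) -> (forall u, 0 <= t u <= c) ->
  (\sum_u \sum_v s u * t v * deviation u v) ^+ 2 <= c ^+ 4 * q ^+ 7.
Proof.
move=> sc tc; have c0 : 0 <= c by have /andP[] := sc (0, 0); apply: le_trans.
pose X v := \sum_u s u * deviation u v.
have -> : \sum_u \sum_v s u * t v * deviation u v = \sum_v t v * X v.
  rewrite exchange_big; apply: eq_bigr => v _; rewrite mulr_sumr.
  by apply: eq_bigr => u _; ring.
apply: le_trans (sum_sqr_ge _) _.
have cU : #|U|%:R = q ^+ 2 :> R by rewrite card_prod natrM expr2.
have X2 : \sum_v X v ^+ 2 <= c ^+ 2 * q ^+ 5.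
  have -> : \sum_v X v ^+ 2 = \sum_u \sum_u' s u * s u' * \sum_v deviation u v * deviation u' v.
    have E v : X v ^+ 2 = \sum_u \sum_u' s u * s u' * (deviation u v * deviation u' v).
      rewrite expr2 mulr_suml; apply: eq_bigr => u _; rewrite mulr_sumr.
      by apply: eq_bigr => u' _; ring.
    rewrite (eq_bigr _ (fun v _ => E v)) exchange_big; apply: eq_bigr => u _.
    by rewrite exchange_big; apply: eq_bigr => u' _; rewrite mulr_sumr.
  apply: le_trans (_ : \sum_(u : U) \sum_(u' : U | u'.1 == u.1) c ^+ 2 * q ^+ 2 <= _).
    apply: ler_sum => u _; rewrite [leRHS]big_mkcond; apply: ler_sum => u' _.
    case: ifP => [_|uu']; last by rewrite deviation_orthogonal ?mulr0 // eq_sym uu'.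
    have /andP[su0 suc] := sc u; have /andP[su'0 su'c] := sc u'.
    have : s u * s u' <= c ^+ 2 by rewrite expr2 ler_pM.
    have : \sum_v deviation u v * deviation u' v <= q ^+ 2.
      rewrite -cU -sumr_const; apply: ler_sum => v _; apply: le_trans (ler_norm _) _.
      by rewrite normrM mulr_ile1 // deviation_itv.
    move=> h1 h2; apply: le_trans (ler_wpM2l (mulr_ge0 su0 su'0) h1) _.
    by rewrite ler_wpM2r // exprn_ge0 // ltW.
  have row (u : U) (K : R) : \sum_(u' : U | u'.1 == u.1) K = q * K.
    have -> : \sum_(u' : U | u'.1 == u.1) K = \sum_(a' | a' == u.1) \sum_(b' : F) K.
      by rewrite pair_big; apply: eq_bigl => -[a b] /=; rewrite andbT.
    by rewrite big_pred1_eq sumr_const mulr_natl.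
  under eq_bigr do rewrite row.
  by rewrite sumr_const -(mulr_natl (q * _)) cU le_eqVlt; apply/orP; left; apply/eqP; ring.
have c2 : 0 <= c ^+ 2 by rewrite exprn_ge0.
have tX : \sum_v (t v * X v) ^+ 2 <= c ^+ 2 * \sum_v X v ^+ 2.
  rewrite mulr_sumr; apply: ler_sum => v _; rewrite exprMn ler_wpM2r ?sqr_ge0 //.
  by have /andP[t0 t1] := tc v; rewrite lerXn2r.
rewrite cU; have h := le_trans tX (ler_wpM2l c2 X2).
have q2 : 0 <= q ^+ 2 by rewrite exprn_ge0 // ltW.
apply: le_trans (ler_wpM2l q2 h) _.
by rewrite le_eqVlt; apply/orP; left; apply/eqP; ring.
Qed.

End LineIncidence.

Section Quasirandom.
Variable R : realType.

(* The graph of the incidence relation over F_q with values in a set of about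
   p q elements, blown up to n vertices; then an exact edge count is enforced. *)
Lemma quasirandom_graph (p gamma : R) : 0 < p < 1 -> 0 < gamma ->
  exists n0 : nat, forall n : nat, (n0 <= n)%N -> exists G : graph 'I_n,
    #|edges G|%:Z = Num.floor (p * 'C(n, 2)%:R) /\
    cut_le (fun x y => (adj G x y)%:R - p) gamma.
Proof.
move=> /andP[p0 p1] g0; pose g := gamma / 16.
have g_gt0 : 0 < g by rewrite divr_gt0.
(* The term $16/g^2$ serves the cut estimate, where $c q^2 \le 2n$ produces $(2n)^4$; the term $1/g$
   serves the rounding of [p] to a multiple of $1/q$. *)
have [q0 q_prime q_gt] : exists2 q : nat, prime q & 16 / g ^+ 2 + 1 / g < q%:R.
  have [q qlt qp] := prime_above (Num.truncn (16 / g ^+ 2 + 1 / g)).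
  exists q => //; apply: lt_le_trans (truncnS_gt _) _.
  by rewrite ler_nat.
pose F : finFieldType := 'F_q0.
have cF : #|F| = q0 by rewrite card_Fp.
pose q : R := #|F|%:R.
rewrite -cF -/q in q_gt.
have q_gt0 : 0 < q by rewrite ltr0n cF prime_gt0.
have [j [jq pj jp]] : exists j : nat, [/\ (j <= #|F|)%N, j%:R / q <= p & p - 1 / q <= j%:R / q].
  exists (Num.truncn (p * q)); have pq0 : 0 <= p * q by rewrite mulr_ge0 // ltW.
  have t1 : (Num.truncn (p * q))%:R <= p * q by rewrite truncn_le.
  have t2 := truncnS_gt (p * q).
  split.
  - rewrite -(ler_nat R) (le_trans t1) // ler_piMl // ltW //.
  - by rewrite ler_pdivrMr.
  - rewrite -(ler_pM2r q_gt0) mulrBl !divfK ?gt_eqF //.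
    by move: t2; rewrite -natr1; lra.
have [A Aj] : exists A : {set F}, #|A| = j.
  exists [set x in take j (enum F)]%SET.
  by rewrite cardsE; move/card_uniqP: (take_uniq j (enum_uniq F)) => ->; rewrite size_takel // -cardE.
pose U : finType := (F * F)%type.
have cU : #|U| = (#|F| * #|F|)%N by rewrite card_prod.
have U0 : (0 < #|U|)%N by rewrite cU cF muln_gt0 prime_gt0.
(* Having at least as many vertices as [U] bounds each fibre by $2n/|U|$; $gn \ge 4$ absorbs the
   diagonal and the terms linear in [n]. *)
exists (#|U| + (Num.truncn (4 / g)).+1)%N => n nU.
have n_gt0 : (0 < n)%N by apply: leq_trans nU; rewrite addn_gt0 U0.
have card_n (S : {set 'I_n}) : (#|S| <= n)%N by rewrite (leq_trans (max_card _)) ?card_ord.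
have nR : 0 < n%:R :> R by rewrite ltr0n.
have ng : 4 <= g * n%:R.
  rewrite mulrC -ler_pdivrMr //; apply: le_trans (ltW (truncnS_gt _)) _.
  by rewrite ler_nat (leq_trans _ nU) // leq_addl.
have Un : (#|U| <= n)%N by apply: leq_trans nU; exact: leq_addr.
pose r (x : 'I_n) : U := enum_val (Ordinal (ltn_pmod x U0)).
pose b x y : bool := incidence (r x) (r y) \in A.
have fiber (u : U) (S : {set 'I_n}) : (#|[set x in S | r x == u]%SET| <= n %/ #|U| + 1)%N.
  rewrite -[X in (_ <= X)%N]card_ord.
  have lt_d (x : 'I_n) : (x %/ #|U| < n %/ #|U| + 1)%N.
    by rewrite addn1 ltnS leq_div2r // ltnW.
  rewrite -(card_in_imset (f := fun x : 'I_n => Ordinal (lt_d x))); first exact: max_card.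
  move=> x y; rewrite !inE => /andP[_ /eqP rx] /andP[_ /eqP ry] [dxy].
  have /enum_val_inj[mxy] : r x = r y by rewrite rx ry.
  by apply: val_inj; rewrite /= (divn_eq x #|U|) (divn_eq y #|U|) dxy mxy.
pose c : R := (n %/ #|U| + 1)%:R.
have cq : c * q ^+ 2 <= 2 * n%:R.
  have -> : q ^+ 2 = #|U|%:R by rewrite cU natrM expr2.
  by rewrite -natrM -natrM ler_nat mulnDl mul1n mul2n -addnn leq_add // leq_divM.
have cut_b (S T : {set 'I_n}) :
    `|\sum_(x in S) \sum_(y in T) ((b x y)%:R - #|A|%:R / q)| <= g * n%:R ^+ 2.
  pose s (S : {set 'I_n}) (u : U) : R := #|[set x in S | r x == u]%SET|%:R.
  have sc S' u : 0 <= s S' u <= c by rewrite ler0n ler_nat fiber.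
  have -> : \sum_(x in S) \sum_(y in T) ((b x y)%:R - #|A|%:R / q) =
      \sum_u \sum_v s S u * s T v * deviation R A u v.
    rewrite (partition_big r xpredT) //=; apply: eq_bigr => u _.
    rewrite exchange_big /= (partition_big r xpredT) //=; apply: eq_bigr => v _.
    have -> : s S u * s T v * deviation R A u v = \sum_(y in [set y in T | r y == v]%SET)
        \sum_(x in [set x in S | r x == u]%SET) deviation R A u v.
      by rewrite !sumr_const -mulrnA -(mulr_natl (deviation _ _ _ _)) natrM.
    apply: eq_big => [y|y /andP[_ /eqP ry]]; first by rewrite inE.
    apply: eq_big => [x|x /andP[_ /eqP rx]]; first by rewrite inE.
    by rewrite /deviation -rx -ry.
  have := deviation_cut A (sc S) (sc T); rewrite -/q.
  set X := \sum_u _; move=> h.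
  have gn : 0 <= g * n%:R ^+ 2 by rewrite mulr_ge0 ?exprn_ge0 ?ler0n // ltW.
  rewrite -ler_sqr ?nnegrE ?normr_ge0 // real_normK ?num_real //.
  apply: le_trans h _; rewrite -(ler_pM2r q_gt0).
  have cq4 : (c * q ^+ 2) ^+ 4 <= (2 * n%:R) ^+ 4.
    have cq0 : 0 <= c * q ^+ 2 by rewrite mulr_ge0 ?ler0n // exprn_ge0 // ltW.
    by apply: lerXn2r cq => //; rewrite nnegrE mulr_ge0 ?ler0n.
  have -> : c ^+ 4 * q ^+ 7 * q = (c * q ^+ 2) ^+ 4 by ring.
  apply: le_trans cq4 _.
  have -> : (g * n%:R ^+ 2) ^+ 2 * q = (g ^+ 2 * q) * n%:R ^+ 4 by ring.
  have -> : (2 * n%:R) ^+ 4 = 16 * n%:R ^+ 4 :> R by ring.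
  rewrite ler_wpM2r ?exprn_ge0 ?ler0n // mulrC -ler_pdivrMr ?exprn_gt0 //.
  have : 0 < 1 / g by rewrite divr_gt0.
  lra.
have pd : `|#|A|%:R / q - p| <= g.
  rewrite Aj; have : 1 / q <= g.
    rewrite ler_pdivrMr // mulrC -ler_pdivrMr //.
    have : 0 < 16 / g ^+ 2 by rewrite divr_gt0 ?exprn_gt0.
    lra.
  by rewrite ler_norml; lra.
have [||G1 G1b] := @graph_of_rel 'I_n (fun x y => (x != y) && b x y).
- by move=> x y; rewrite eq_sym /b incidence_sym.
- by move=> x; rewrite eqxx.
(* One [g] each for the incidence deviation, for the rounding of [p], and for the removed
   diagonal. *)
have cut1 : cut_le (fun x y => (adj G1 x y)%:R - p) (3 * g).
  move=> S T; rewrite card_ord.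
  have E : \sum_(x in S) \sum_(y in T) ((adj G1 x y)%:R - p) =
     \sum_(x in S) \sum_(y in T) ((b x y)%:R - #|A|%:R / q) +
     (\sum_(x in S) \sum_(y in T) (#|A|%:R / q - p) -
      \sum_(x in S) \sum_(y in T) ((x == y) && b x y)%:R).
    rewrite -sumrB -big_split; apply: eq_bigr => x _ /=.
    rewrite -sumrB -big_split; apply: eq_bigr => y _ /=.
    rewrite G1b; case: eqP => _; case: (b x y) => /=; lra.
  have h1 : `|\sum_(x in S) \sum_(y in T) (#|A|%:R / q - p)| <= g * n%:R ^+ 2.
    rewrite !sumr_const -mulrnA -(mulr_natr (_ - _)) normrM.
    rewrite ler_pM ?normr_ge0 // (@ger0_norm _ _%:R) ?ler0n // natrM expr2.
    by rewrite ler_pM ?ler0n // ler_nat card_n.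
  have h2 : `|\sum_(x in S) \sum_(y in T) ((x == y) && b x y)%:R| <= n%:R :> R.
    rewrite ger0_norm; last by apply: sumr_ge0 => x _; apply: sumr_ge0 => y _; rewrite ler0n.
    apply: le_trans (_ : \sum_(x in S) 1 <= _); last by rewrite sumr_const ler_nat card_n.
    apply: ler_sum => x _; apply: le_trans (_ : \sum_(y : 'I_n) (x == y)%:R <= _).
      rewrite big_mkcond; apply: ler_sum => y _; case: (y \in T); last by rewrite ler0n.
      by case: eqP; case: (b x y); rewrite ?ler0n.
    by rewrite (bigD1 x) //= eqxx big1 ?addr0 // => y; rewrite eq_sym => /negPf->.
  have h3 : n%:R <= g * n%:R ^+ 2 :> R.
    have : n%:R * 1 <= n%:R * (g * n%:R) :> R by rewrite ler_wpM2l ?ler0n //; lra.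
    by rewrite mulr1 expr2 mulrCA.
  rewrite E; have := ler_normD (\sum_(x in S) \sum_(y in T) ((b x y)%:R - #|A|%:R / q))
    (\sum_(x in S) \sum_(y in T) (#|A|%:R / q - p) -
      \sum_(x in S) \sum_(y in T) ((x == y) && b x y)%:R).
  have := ler_normB (\sum_(x in S) \sum_(y in T) (#|A|%:R / q - p))
     (\sum_(x in S) \sum_(y in T) ((x == y) && b x y)%:R : R).
  have := cut_b S T; lra.
have C0 : 0 <= 'C(n, 2)%:R :> R by rewrite ler0n.
pose m := Num.truncn (p * 'C(n, 2)%:R).
have pC0 : 0 <= p * 'C(n, 2)%:R by rewrite mulr_ge0 // ltW.
have m1 : m%:R <= p * 'C(n, 2)%:R by rewrite truncn_le.
have m2 : p * 'C(n, 2)%:R < m%:R + 1 by rewrite natr1; exact: truncnS_gt.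
have [|G [Gm Gd]] := adjust_edge_number R G1 (m := m).
  by rewrite card_ord -(ler_nat R) (le_trans m1) // ler_piMl // ltW.
exists G; split.
  have : 0 <= Num.floor (p * 'C(n, 2)%:R) by rewrite floor_ge0.
  by rewrite Gm /m truncEfloor; case: (Num.floor _).
have C2 : 2 * 'C(n, 2)%:R = n%:R ^+ 2 - n%:R :> R.
  have -> : 2 * 'C(n, 2)%:R = ('C(n, 2).*2)%:R :> R by rewrite -muln2 natrM mulrC.
  rewrite bin2 halfK; case: (n) n_gt0 => // n' _ /=.
  rewrite oddM /= andNb subn0 natrM -[n'.+1]addn1 natrD; ring.
have diff : 2 * `|m%:R - #|edges G1|%:R| <= 5 * g * n%:R ^+ 2.
  have := cut1 [set: 'I_n]%SET [set: 'I_n]%SET.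
  have -> : \sum_(x in [set: 'I_n]%SET) \sum_(y in [set: 'I_n]%SET) ((adj G1 x y)%:R - p) =
      2 * #|edges G1|%:R - p * n%:R ^+ 2.
    rewrite -sum_adj.
    have -> : p * n%:R ^+ 2 = \sum_(x : 'I_n) \sum_(y : 'I_n) p.
      by rewrite !sumr_const !card_ord -mulrnA -(mulr_natr p) natrM expr2.
    rewrite -sumrB; apply: eq_big => [x|x _]; first by rewrite inE.
    by rewrite -sumrB; apply: eq_big => [y|y _]; first by rewrite inE.
  rewrite card_ord ler_norml => /andP[h1 h2].
  have h3 : 4 * n%:R <= g * n%:R ^+ 2 :> R by rewrite expr2 mulrA ler_wpM2r ?ler0n.
  have h4 : 1 <= n%:R :> R by rewrite (ler_nat _ 1).
  have h5 : p * n%:R <= n%:R by rewrite ler_piMl ?ler0n // ltW.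
  have h6 : 2 * (p * 'C(n, 2)%:R) = p * n%:R ^+ 2 - p * n%:R by rewrite mulrCA C2; ring.
  have : `|m%:R - #|edges G1|%:R| <= 5 * g * n%:R ^+ 2 / 2.
    have arith (x e1 y c1 c2 c3 n' : R) : x <= c1 -> c1 < x + 1 ->
        - (3 * y) <= 2 * e1 - c2 -> 2 * e1 - c2 <= 3 * y -> 4 * n' <= y -> 1 <= n' ->
        c3 <= n' -> 0 <= c3 -> 2 * c1 = c2 - c3 -> `|x - e1| <= 5 * y / 2.
      by move=> *; rewrite ler_norml; lra.
    rewrite -[5 * g * _]mulrA; rewrite -[3 * g * _]mulrA in h1 h2.
    apply: arith m1 m2 h1 h2 h3 h4 h5 _ h6.
    by rewrite mulr_ge0 ?ler0n // ltW.
  lra.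
move=> S T; have := cut1 S T; rewrite card_ord.
have -> : \sum_(x in S) \sum_(y in T) ((adj G x y)%:R - p) =
   \sum_(x in S) \sum_(y in T) ((adj G1 x y)%:R - p) +
   \sum_(x in S) \sum_(y in T) ((adj G x y)%:R - (adj G1 x y)%:R).
  rewrite -big_split; apply: eq_bigr => x _; rewrite -big_split.
  by apply: eq_bigr => y _ /=; ring.
have : `|\sum_(x in S) \sum_(y in T) ((adj G x y)%:R - (adj G1 x y)%:R)| <=
    2 * `|m%:R - #|edges G1|%:R| :> R.
  rewrite -Gd; apply: le_trans (ler_norm_sum _ _ _) _; rewrite big_mkcond.
  apply: ler_sum => x _; case: ifP => _; last by apply: sumr_ge0 => y _.
  apply: le_trans (ler_norm_sum _ _ _) _; rewrite big_mkcond.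
  by apply: ler_sum => y _; case: ifP.
set a1 := \sum_(x in S) _; set a2 := \sum_(x in S) _ => h1 h2.
have := ler_normD a2 a1.
have : gamma = 16 * g by rewrite /g; field.
have : 0 <= g * n%:R ^+ 2 by rewrite mulr_ge0 ?exprn_ge0 ?ler0n // ltW.
move=> h3 -> h4; lra.
Qed.

End Quasirandom.

(** * The upper bound *)

Section WhiteAndThreeBlack.
Variable h : nat.
Hypotheses (h_ge : (10 <= h)%N)
  (tri_free : forall i j l : 'I_h, ~~ [&& adj (C_ h) i j, adj (C_ h) j l & adj (C_ h) l i]).

(* An independent set and three cliques cannot cover the cycle: the successors
   of the independent vertices lie in distinct cliques, and cliques have at
   most two vertices. *)
Lemma cycle_not_covered (kappa : 'I_h -> 'I_4) :
  ~ (forall i j, i != j -> kappa i = kappa j -> adj (C_ h) i j = (kappa i != ord0)).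
Proof.
move=> H; have h2 : (2 < h)%N by apply: leq_trans h_ge.
pose B a := [set i | kappa i == a]%SET.
have B2 a : a != ord0 -> (#|B a| <= 2)%N.
  move=> a0; rewrite leqNgt; apply/negP => /card_gt2P[i [j [l [[]]]]].
  rewrite !inE => /eqP ia /eqP ja /eqP la [ij jl li].
  by have := tri_free i j l; rewrite !H ?ia ?ja ?la // a0.
have hB : h = (\sum_a #|B a|)%N.
  rewrite -[LHS]card_ord -sum1_card (partition_big kappa xpredT) //=.
  apply: eq_bigr => a _; rewrite sum1_card; apply: eq_card => i.
  by rewrite inE [in LHS]unfold_in.
(* The three cliques hold at most six vertices, so at least four are white: one too many for their
   successors to lie in distinct cliques. *)
have I4 : (3 < #|B ord0|)%N.
  rewrite -(leq_add2r 6); apply: leq_trans h_ge _.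
  apply: leq_trans (_ : \sum_a #|B a| <= _)%N; first by rewrite -hB.
  rewrite (bigD1 ord0) //= leq_add2l.
  apply: leq_trans (_ : \sum_(a : 'I_4 | a != ord0) 2 <= _)%N.
    by apply: leq_sum => a; exact: B2.
  by rewrite sum_nat_const cardC1 card_ord.
have next_adj (i : 'I_h) : adj (C_ h) i (ordS i) by rewrite adj_C // /cyc /= eqxx.
have next_ne (i : 'I_h) : i != ordS i.
  by apply: contraTneq (next_adj i) => <-; rewrite adj_irr.
have next_black i : i \in B ord0 -> kappa (ordS i) \in [set~ ord0 : 'I_4]%SET.
  rewrite !inE => /eqP i0; apply/eqP => si0.
  by have := H i (ordS i) (next_ne i); rewrite i0 si0 next_adj eqxx => /(_ erefl).
have next_inj : {in B ord0 &, injective (fun i => kappa (ordS i))}.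
  move=> i j iB jB kij; apply/eqP; apply/negP => /negP ij.
  have sij : ordS i != ordS j by rewrite (inj_eq (@ordS_inj h)).
  have := H _ _ sij kij; have := next_black i iB; rewrite !inE => -> /esym.
  have white_nadj i' j' : i' \in B ord0 -> j' \in B ord0 -> i' != j' -> j' != ordS i'.
    rewrite !inE => /eqP i0 /eqP j0 ij'; apply: contraTneq (next_adj i') => <-.
    by rewrite H // ?i0 ?j0.
  rewrite adj_C // /cyc => /esym/orP[] /eqP e.
    have /ordS_inj e' : ordS (ordS i) = ordS j by apply: val_inj.
    by have := white_nadj i j iB jB ij; rewrite e' eqxx.
  have /ordS_inj e' : ordS (ordS j) = ordS i by apply: val_inj.
  by have := white_nadj j i jB iB; rewrite eq_sym ij e' eqxx => /(_ isT).
have := card_in_imset next_inj; apply/eqP; rewrite neq_ltn (leq_trans _ I4) // ltnS.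
apply: leq_trans (_ : #|[set~ ord0 : 'I_4]%SET| <= 3)%N; last by rewrite cardsC1 card_ord.
by apply/subset_leq_card/fintype.subsetP => a /imsetP[i /next_black ? ->].
Qed.

Lemma recoloured_free (T : finType) (G : graph T) (c : T -> 'I_4) :
  (forall x y, x != y -> c x = c y -> adj G x y = (c x != ord0)) -> Forb (C_ h) G.
Proof.
move=> Gc; apply/negP => /existsP[f /andP[/injectiveP f_inj /forallP fP]].
apply: (@cycle_not_covered (c \o f)) => i j ij cij /=.
rewrite -(Gc (f i) (f j)) ?(inj_eq f_inj) //.
by apply/esym/eqP; exact: (forallP (fP i) j).
Qed.

End WhiteAndThreeBlack.

Section WeightedColouring.
Variables (R : realType) (T C : finType) (w : C -> R).
Hypotheses (w_gt0 : forall a, 0 < w a) (w_sum : \sum_a w a = 1).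

(** The expectation of [F] when the vertices are coloured independently with law [w]. *)
Definition colour_mean (F : {ffun T -> C} -> R) : R :=
  \sum_(c : {ffun T -> C}) (\prod_i w (c i)) * F c.

Lemma colour_mean_pair (x y : T) (a : C) : x != y ->
  colour_mean (fun c => ((c x == a) && (c y == a))%:R) = w a ^+ 2.
Proof.
move=> xy; pose v i b := w b * ((i \in pred2 x y) ==> (b == a))%:R.
have E (c : {ffun T -> C}) : (\prod_i w (c i)) * ((c x == a) && (c y == a))%:R = \prod_i v i (c i).
  rewrite big_split /=; congr (_ * _); rewrite (bigD1 x) //= (bigD1 y) 1?eq_sym //=.
  rewrite !inE !eqxx orbT /= big1 ?mulr1 => [|i /andP[/negPf ix /negPf iy]].
    by rewrite -natrM mulnb.
  by rewrite !inE ix iy.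
rewrite /colour_mean (eq_bigr _ (fun c _ => E c)) -(bigA_distr_bigA v).
have va i : i \in pred2 x y -> \sum_b v i b = w a.
  move=> ixy; rewrite (bigD1 a) //= big1 => [|b /negPf ba].
    by rewrite /v ixy eqxx mulr1 addr0.
  by rewrite /v ixy ba mulr0.
rewrite (bigD1 x) //= (bigD1 y) 1?eq_sym //= !va ?inE ?eqxx ?orbT //.
rewrite big1 ?mulr1 ?expr2 // => i /andP[/negPf ix /negPf iy].
by rewrite -w_sum; apply: eq_bigr => b _; rewrite /v !inE ix iy mulr1.
Qed.

Lemma colour_mean_ex (F : {ffun T -> C} -> R) : exists c, F c <= colour_mean F.
Proof.
have W1 : \sum_(c : {ffun T -> C}) \prod_i w (c i) = 1.
  rewrite -(bigA_distr_bigA (fun _ : T => w)).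
  by rewrite big1 // => i _.
have W0 (c : {ffun T -> C}) : 0 < \prod_i w (c i) by apply: prodr_gt0.
apply/not_existsP => H.
have pos (c : {ffun T -> C}) : true -> 0 <= (\prod_i w (c i)) * (F c - colour_mean F).
  by move=> _; rewrite mulr_ge0 ?(ltW (W0 c)) // subr_ge0 ltW // ltNge; apply/negP/H.
have zero : \sum_(c : {ffun T -> C}) (\prod_i w (c i)) * (F c - colour_mean F) = 0.
  under eq_bigr do rewrite mulrBr.
  by rewrite sumrB -mulr_suml W1 mul1r subrr.
have [c _] : exists c : {ffun T -> C}, true.
  apply/existsP; apply: contraPT W1; rewrite negb_exists => /forallP no.
  by rewrite big1 => [/esym/eqP|c]; [rewrite oner_eq0 | have := no c].
have : (\prod_i w (c i)) * (F c - colour_mean F) = 0 by exact: (psumr_eq0P pos zero).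
apply/eqP.
by rewrite mulf_neq0 ?gt_eqF // subr_gt0 ltNge; apply/negP/H.
Qed.

End WeightedColouring.

Section UpperBound.
Variables (R : realType) (h : nat) (p : R).
Hypotheses (h_ge : (10 <= h)%N)
  (tri_free : forall i j l : 'I_h, ~~ [&& adj (C_ h) i j, adj (C_ h) j l & adj (C_ h) l i]).
Hypotheses (p_gt0 : 0 < p) (p_lt1 : p < 1).

(** First moment: an edge is deleted with probability $X^2$ and a non-edge added with probability
    $3Y^2$. At exactly $pN$ edges the mean number of edits is the claimed multiple of $N$; rounding
    the number of edges down changes it by at most one, whence the error $1/N$. *)
Lemma edit_upper_bound (T : finType) (G : graph T) : (1 < #|T|)%N ->
  #|edges G|%:Z = Num.floor (p * 'C(#|T|, 2)%:R) ->
  exists2 G' : graph T, Forb (C_ h) G' &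
    dist R G G' <= p * (1 - p) / (1 + 2 * p) + 'C(#|T|, 2)%:R^-1.
Proof.
have p0 := p_gt0; have p1 := p_lt1.
have q0 : 0 < 1 + 2 * p by lra.
pose X : R := (1 - p) / (1 + 2 * p); pose Y : R := p / (1 + 2 * p).
have X0 : 0 < X by rewrite divr_gt0 //; lra.
have Y0 : 0 < Y by rewrite divr_gt0.
have Y3 : 3 * Y < 1 by rewrite /Y mulrA ltr_pdivrMr //; lra.
move=> T1 Ge; set N := 'C(#|T|, 2)%:R in Ge *; set e : R := #|edges G|%:R.
have N0 : 0 < N by rewrite ltr0n bin_gt0.
pose w (a : 'I_4) : R := if a == ord0 then X else Y.
have w_gt0 a : 0 < w a by rewrite /w; case: ifP.
have w_sum : \sum_a w a = 1.
  by rewrite !big_ord_recl big_ord0 /w /=  /X /Y; field; lra.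
have Gr (c : {ffun T -> 'I_4}) : exists G' : graph T,
    adj G' =2 (fun x y => (x != y) && (if c x == c y then c x != ord0 else adj G x y)).
  apply: graph_of_rel => [x y|x]; last by rewrite eqxx.
  by rewrite (eq_sym x) (eq_sym (c x)) (adj_sym G x); have [->|] := eqVneq (c y) (c x).
have [f fP] := fin_all_exists Gr.
pose D (c : {ffun T -> 'I_4}) := \sum_x \sum_y `|(adj G x y)%:R - (adj (f c) x y)%:R| : R.
pose al (x y : T) : R := (adj G x y)%:R; pose be (x y : T) : R := ((x != y) && ~~ adj G x y)%:R.
have DE c : D c = \sum_x \sum_y (al x y * ((c x == ord0) && (c y == ord0))%:R +
     be x y * \sum_(a | a != ord0) ((c x == a) && (c y == a))%:R).
  apply: eq_bigr => x _; apply: eq_bigr => y _; rewrite fP /al /be.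
  have [->|xy] /= := eqVneq x y; first by rewrite adj_irr subrr normr0 !mul0r addr0.
  have [cxy|cxy] := eqVneq (c x) (c y); last first.
    have n0 a : (c x == a) && (c y == a) = false.
      by apply/negbTE; apply: contra cxy => /andP[/eqP-> /eqP->].
    by rewrite n0 subrr normr0 big1 ?mulr0 ?addr0 => [|a _]; rewrite ?n0.
  rewrite cxy andbb; have [c0|c0] /= := eqVneq (c y) ord0.
    rewrite c0 big1 ?mulr0 ?addr0 ?mulr1 ?subr0 ?ger0_norm ?ler0n // => a.
    by rewrite andbb eq_sym => /negPf->.
  rewrite mulr0 add0r (bigD1 (c y)) //= eqxx big1 ?addr0 ?mulr1 => [|a /andP[_]].
    by case: (adj G x y); rewrite ?subrr ?normr0 // sub0r normrN normr1.
  by rewrite andbb eq_sym => /negPf->.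
have al_sum : \sum_x \sum_y al x y = 2 * e by exact: sum_adj.
have be_sum : \sum_x \sum_y be x y = 2 * (N - e).
  have -> : \sum_x \sum_y be x y = \sum_x \sum_y (1 - (x == y)%:R - al x y).
    apply: eq_bigr => x _; apply: eq_bigr => y _; rewrite /al /be.
    have [->|_] := eqVneq x y; first by rewrite adj_irr /=; lra.
    by case: (adj G x y) => /=; lra.
  under eq_bigr do rewrite sumrB; rewrite sumrB al_sum mulrBr; congr (_ - _).
  have -> : \sum_(x : T) \sum_y (1 - (x == y)%:R) = \sum_(x : T) (#|T|%:R - 1) :> R.
    apply: eq_bigr => x _; rewrite sumrB sumr_const; congr (_ - _).
    by rewrite (bigD1 x) //= eqxx big1 ?addr0 // => y; rewrite eq_sym => /negPf->.
  have -> : 2 * N = ('C(#|T|, 2).*2)%:R by rewrite -muln2 natrM mulrC.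
  rewrite sumr_const bin2 halfK; case: #|T| T1 => // n _ /=.
  by rewrite oddM /= andNb subn0 -natr1 addrK -mulrnA mulnC.
have mean_D : colour_mean w D = 2 * (e * X ^+ 2 + (N - e) * (3 * Y ^+ 2)).
  have -> : colour_mean w D = \sum_x \sum_y (al x y * X ^+ 2 + be x y * (3 * Y ^+ 2)).
    have step (c : {ffun T -> 'I_4}) : (\prod_i w (c i)) * D c = \sum_x \sum_y (\prod_i w (c i)) *
        (al x y * ((c x == ord0) && (c y == ord0))%:R +
         be x y * \sum_(a | a != ord0) ((c x == a) && (c y == a))%:R).
      by rewrite DE mulr_sumr; apply: eq_bigr => x _; rewrite mulr_sumr.
    rewrite /colour_mean (eq_bigr _ (fun c _ => step c)).
    rewrite exchange_big; apply: eq_bigr => x _; rewrite exchange_big.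
    apply: eq_bigr => y _ /=.
    have [->|xy] := eqVneq x y.
      by rewrite /al /be adj_irr eqxx big1 => [|c _]; rewrite !mul0r addr0 ?mulr0.
    have P a := colour_mean_pair w_sum a xy; rewrite /colour_mean in P.
    under eq_bigr do rewrite mulrDr; rewrite big_split /=; congr (_ + _).
      under eq_bigr do rewrite mulrCA; rewrite -mulr_sumr P /w eqxx //.
    under eq_bigr do rewrite mulrCA mulr_sumr; rewrite -mulr_sumr; congr (_ * _).
    rewrite exchange_big /= (eq_bigr (fun=> Y ^+ 2)) => [|a a0]; last by rewrite P /w (negPf a0).
    by rewrite sumr_const cardC1 card_ord mulr_natl.
  under eq_bigr do rewrite big_split -!mulr_suml.
  by rewrite big_split -!mulr_suml al_sum be_sum /=; ring.
have [c Dc] := colour_mean_ex w_gt0 w_sum D.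
exists (f c).
  apply: (recoloured_free h_ge tri_free (c := c)) => x y xy cxy.
  by rewrite fP xy cxy eqxx.
rewrite /dist -/N; set d := #|_|%:R.
have dD : 2 * d <= 2 * (e * X ^+ 2 + (N - e) * (3 * Y ^+ 2)).
  by rewrite -mean_D; apply: le_trans Dc; rewrite /D sum_adj_diff.
have e1 : e <= p * N.
  have : (Num.floor (p * N))%:~R <= p * N by exact: floor_le.
  by rewrite -Ge.
have e2 : p * N - 1 <= e.
  have : p * N < (Num.floor (p * N) + 1)%:~R by exact: floorD1_gt.
  by rewrite -Ge intrD /=; rewrite -/e; lra.
rewrite ler_pdivrMr // mulrDl mulVf ?gt_eqF //.
have -> : p * (1 - p) / (1 + 2 * p) = p * X ^+ 2 + (1 - p) * (3 * Y ^+ 2).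
  by rewrite /X /Y; field; lra.
have X2 : 0 <= X ^+ 2 by rewrite sqr_ge0.
have Y2 : 3 * Y ^+ 2 <= 1 by nra.
have Y2' : 0 <= Y ^+ 2 by rewrite sqr_ge0.
have : (e - (p * N - 1)) * (3 * Y ^+ 2) >= 0 by rewrite mulr_ge0 //; lra.
have : (p * N - e) * X ^+ 2 >= 0 by rewrite mulr_ge0 //; lra.
have : (p * N - e) * (1 - 3 * Y ^+ 2) >= 0 by rewrite mulr_ge0 //; lra.
nra.
Qed.

End UpperBound.

(** * The limit *)

Section EditDistanceLimit.
Variables (R : realType) (h : nat).
Hypotheses (h_ge : (10 <= h)%N)
  (tri_free : forall i j l : 'I_h, ~~ [&& adj (C_ h) i j, adj (C_ h) j l & adj (C_ h) l i])
  (rich : richly_contractible (adj (C_ h))) (tw : twin_free (adj (C_ h))).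

Lemma max_dist_Forb_cycle_cvg (p : R) : 0 < p -> 7 * p < 1 ->
  (max_dist (Forb (C_ h)) p @ \oo --> (p * (1 - p) / (1 + 2 * p))%R)%classic.
Proof.
move=> p0 p7; set g := _ / _.
have g0 : 0 <= g by rewrite divr_ge0 ?mulr_ge0 //; lra.
have g1 : g <= 1 by rewrite ler_pdivrMr; nra.
have p1 : p < 1 by lra.
have p01 : 0 < p < 1 by rewrite p0.
have le_bin2 (m k : nat) : (m < k)%N -> (m <= 'C(k, 2))%N.
  by case: k => // k; rewrite ltnS binS bin1 => /leq_trans; apply; exact: leq_addl.
apply/cvgrPdist_le => eps eps0.
have [gamma gamma0 lower] := distance_lower_bound rich tw p0 p7 eps0.
have [n0 quasi] := quasirandom_graph p01 gamma0.
near=> n.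
have n_ge : (n0 + (Num.truncn eps^-1).+4 <= n)%N by near: n; exact: nbhs_infty_ge.
have n2 : (1 < n)%N by rewrite (leq_trans _ n_ge) // !addnS.
have nn0 : (n0 <= n)%N by rewrite (leq_trans _ n_ge) // leq_addr.
have Ceps : 'C(n, 2)%:R^-1 <= eps.
  have le_C : (Num.truncn eps^-1).+1%:R <= 'C(n, 2)%:R :> R.
    rewrite ler_nat; apply: le_bin2; apply: leq_trans n_ge.
    by rewrite ltn_addl // !ltnS leqW.
  have lt_C := lt_le_trans (truncnS_gt _) le_C.
  by rewrite -[leRHS]invrK lef_pV2 ?posrE ?invr_gt0 // ?(lt_trans _ lt_C) ?invr_gt0 // ltW.
rewrite ler_norml; apply/andP; split; last first.
  have [G [Ge Gcut]] := quasi n nn0.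
  rewrite lerBlDr -lerBlDl; apply: le_trans (_ : dist_class R G (Forb (C_ h)) <= _).
    (* The default value 1 of the minimum also has to dominate the bound, which it does since $g \le
       1$. *)
    rewrite /dist_class; apply: le_bigmin; first lra.
    move=> G' free; apply: le_trans (dist_avg R G G' _); last by rewrite card_ord.
    by apply: lower => //; rewrite card_ord ltnW.
  rewrite /max_dist; apply: (@le_bigmax_cond _ _ _ _ _ _ (fun G : graph 'I_n => dist_class R G (Forb (C_ h)))).
  exact/eqP.
suff : max_dist (Forb (C_ h)) p n <= g + eps by lra.
rewrite /max_dist; apply: bigmax_le => [|G /eqP Ge]; first lra.
have [||G' free dG'] := edit_upper_bound h_ge tri_free p0 p1 (G := G); rewrite ?card_ord //.
have dG : dist_class R G (Forb (C_ h)) <= dist R G G'.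
  exact: (bigmin_le_cond _ (fun G' => dist R G G')).
apply: le_trans dG _.
apply: le_trans dG' _; by rewrite card_ord -/g lerD2l.
Unshelve. all: by end_near.
Qed.

Lemma ed_Forb_cycle (p : R) : 0 < p -> 7 * p < 1 ->
  cvgn (max_dist (Forb (C_ h)) p) /\
  ed (Forb (C_ h)) p = p * (1 - p) / (1 + 2 * p).
Proof.
move=> p0 p7; have cv := max_dist_Forb_cycle_cvg p0 p7.
split; first by apply/cvg_ex; exists (p * (1 - p) / (1 + 2 * p)).
exact: cvg_lim.
Qed.

End EditDistanceLimit.

Lemma twin_free_C (h : nat) : (2 < h)%N ->
  all (fun i => all (fun j => (i == j) || has (fun l => cyc h i l != cyc h j l) (iota 0 h))
    (iota 0 h)) (iota 0 h) ->
  twin_free (adj (C_ h)).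
Proof.
move=> h2 /allP H i j ij.
have iI (k : 'I_h) : nat_of_ord k \in iota 0 h by rewrite mem_iota add0n ltn_ord.
have /allP/(_ _ (iI j)) := H _ (iI i); rewrite val_eqE (negPf ij) /= => /hasP[l].
by rewrite mem_iota add0n => /= lh ne; exists (Ordinal lh); rewrite !adj_C.
Qed.

Lemma triangle_free_C (h : nat) : (2 < h)%N ->
  all (fun i => all (fun j => all (fun l => ~~ [&& cyc h i j, cyc h j l & cyc h l i])
    (iota 0 h)) (iota 0 h)) (iota 0 h) ->
  forall i j l : 'I_h, ~~ [&& adj (C_ h) i j, adj (C_ h) j l & adj (C_ h) l i].
Proof.
move=> h2 /allP H i j l.
have iI (k : 'I_h) : nat_of_ord k \in iota 0 h by rewrite mem_iota add0n ltn_ord.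
rewrite !adj_C //.
by have /allP/(_ _ (iI j))/allP/(_ _ (iI l)) := H _ (iI i).
Qed.

Theorem theorem1p4 (R : realType) :
  (forall p : R, 0 < p < 1 / 7 ->
     cvgn (max_dist (Forb (C_ 10)) p) /\
     ed (Forb (C_ 10)) p = p * (1 - p) / (1 + 2 * p)) /\
  (forall p : R, 0 < p < 1 / 10 ->
     cvgn (max_dist (Forb (C_ 12)) p) /\
     ed (Forb (C_ 12)) p = p * (1 - p) / (1 + 2 * p)).
Proof.
split=> p /andP[p0 p1]; apply: ed_Forb_cycle => //; try lra.
- by apply: triangle_free_C => //; vm_compute.
- exact: C10_richly_contractible.
- by apply: twin_free_C => //; vm_compute.
- by apply: triangle_free_C => //; vm_compute.
- exact: C12_richly_contractible.
- by apply: twin_free_C => //; vm_compute.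
Qed.
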